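(* Suppose $(X,d)$ is a locally compact bounded metric space. Let $\mathcal{M}$ be a uniformly bounded in variation family of topological measures (respectively, of deficient topological measures) on $X$. Let $\{X,q_i^*,\alpha_i\}$ be an image transformation system (respectively, a d-image transformation system) with contractivity factor $s<1$, $\alpha_i\ge0$ and $\sum_{i=1}^\infty\alpha_i\le1$. The Markov operator $S$ associated with $\{X,q_i^*,\alpha_i\}$, $S(\mu)=\sum_{i=1}^\infty\alpha_i\,q_i^*(\mu)$, is a contraction on $(\mathcal{M},d_{KR})$, and has a unique fixed point $\mu_0\in\mathcal{M}$. If $\mathcal{M}$ is $\mathbf{DTM}_1(X)$ or $\mathbf{TM}_1(X)$, then $\mu_0$ is representable.
   Context: All spaces are Hausdorff. $\mathscr{O}(X),\mathscr{C}(X),\mathscr{K}(X)$ denote the open, closed, compact subsets of $X$; $\sqcup$ is disjoint union. A topological measure on a locally compact $X$ is a map $\mu:\mathscr{C}(X)\cup\mathscr{O}(X)\to[0,\infty]$, not identically $\infty$, such that: (TM1) if $A,B,A\sqcup B\in\mathscr{K}(X)\cup\mathscr{O}(X)$ then $\mu(A\sqcup B)=\mu(A)+\mu(B)$; (TM2) $\mu(U)=\sup\{\mu(K):K\in\mathscr{K}(X),K\subseteq U\}$ for open $U$; (TM3) $\mu(F)=\inf\{\mu(U):U\in\mathscr{O}(X),F\subseteq U\}$ for closed $F$. If (TM1) is required only for compact $A,B$, $\mu$ is a deficient topological measure. $\|\mu\|=\mu(X)$; $\mu$ is finite if $\mu(X)<\infty$. $\mathbf{TM}_1(X)$, $\mathbf{DTM}_1(X)$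 are the sets of topological, deficient topological measures with $\|\mu\|=1$. A family $\mathcal{M}$ of finite (deficient) topological measures is uniformly bounded in variation if there is a constant $M>0$ with $\|\mu\|\le M$ for each $\mu\in\mathcal{M}$. $C(X)$: continuous real-valued functions; $C_0(X)$: those $f\in C(X)$ with $\{|f|\ge\epsilon\}$ compact for all $\epsilon>0$; $C_c(X)$: continuous functions with compact support; superscript $+$ means nonnegative functions. Quasi-integral: for a finite deficient topological measure $\mu$ and $f\in C_0(X)$ with $f(X)\subseteq[a,b]$, $\int_X f\,d\mu=\int_a^b\mu(f^{-1}((t,\infty)))\,dt+a\,\mu(X)$. Weak topology on finite deficient topological measures: the coarsest making $\mu\mapsto\int_X f\,d\mu$ continuous for all $f\in C_0^+(X)$. $Lip_s(X,d)=\{f\in C(X):|f(x)-f(y)|\le s\,d(x,y)\ \forall x,y\}$. For finite topological measures, $d_{KR}(\mu,\nu)=\sup\{|\int_X f\,d\mu-\int_X f\,d\nu|:f\in Lip_1(X,d)\cap C_c(X)\}$; for finite deficient topological measures the supremum is over nonnegative such $f$. A map $u$ of a metric space to itself is a contraction if there is $c\in[0,1)$ such that it does not increase distances by more than the factor $c$, i.e. the distance from $u(x)$ to $u(y)$ is at most $c$ times the distance from $x$ to $y$. An image transformation on $X$ is a map $q:\mathscr{O}(X)\cup\mathscr{K}(X)\to\mathscr{O}(X)\cup\mathscr{K}(X)$ such that: $q$ takes open sets to open sets and compact sets to compact sets; $q(U)=\bigcup\{q(K):K\subseteq U,K\in\mathscr{K}(X)\}$ for open $U$; $q(K)=\bigcap\{q(U):K\subseteq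 U,U\in\mathscr{O}(X)\}$ for compact $K$; and $q(A\sqcup B)=q(A)\sqcup q(B)$ whenever $A,B,A\sqcup B\in\mathscr{O}(X)\cup\mathscr{K}(X)$. If the last property is required only for compact $A,B$, $q$ is a d-image transformation. The adjoint $q^*$ is given by $(q^*\nu)(A)=\nu(q(A))$ for $A$ open or compact (extended to closed sets by (TM3)). The quasi-homomorphism (respectively, conic quasi-homomorphism) corresponding to $q$ is $\theta(f)(y)=\int_X f\,d(q^*\delta_y)$, where $\delta_y$ is the point mass at $y$. For $0<s<1$, $q$ has contractivity factor $s$ if $\theta(Lip_1(X,d)\cap C_c(X))\subseteq Lip_s(X,d)\cap C_c(X)$ (image transformation), respectively $\theta(Lip_1(X,d)\cap C_c^+(X))\subseteq Lip_s(X,d)\cap C_c^+(X)$ (d-image transformation). A (d-) image transformation system $\{X,q_i^*,\alpha_i\}$ consists of (d-) image transformations $q_i$ on $X$ and numbers $\alpha_i\ge0$, $i=1,2,\ldots$, with $\sum_{i=1}^\infty\alpha_i\le1$; it has contractivity factor $s$ if each $q_i$ has a contractivity factor $s_i\le s$. A (deficient) topological measure is simple if it only assumes values $0$ and $1$. A (deficient) topological measure is representable if it is in the closed convex hull (in the weak topology) of the simple (deficient) topological measures.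
   Formalization: The fixed-point claims fail for arbitrary M: uniqueness is stated when d_KR is finite on M, and existence when also M is nonempty, S(M) is contained in M, and M is d_KR-closed among finite (deficient) topological measures; ''contraction'' is the d_KR inequality, S(M) in M not being claimed. *)

(* Defs.v *)
From HB Require Import structures.
From mathcomp Require Export all_boot all_order all_algebra.
From mathcomp Require Export all_classical all_reals all_analysis.

Set Implicit Arguments.
Unset Strict Implicit.
Unset Printing Implicit Defensive.

Import Order.TTheory GRing.Theory Num.Theory.
Import numFieldNormedType.Exports.

Local Open Scope classical_set_scope.
Local Open Scope ring_scope.

(* Selects the variant of every notion below: [Plain] for topological measures,
   image transformations and all test functions, [Deficient] for deficient
   topological measures, d-image transformations and nonnegative test
   functions. *)
Variant kind := Plain | Deficient.

Section topological_measures.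
Context {R : realType} {X : metricType R}.
Local Open Scope ereal_scope.

Implicit Types (mu nu : set X -> \bar R) (A B K U F : set X) (k : kind).

(* The pairs on which additivity is required, (TM1). *)
Definition additive_pair k A B : Prop :=
  A `&` B = set0 /\
  match k with
  | Plain => [/\ open A \/ compact A, open B \/ compact B
               & open (A `|` B) \/ compact (A `|` B)]
  | Deficient => compact A /\ compact B
  end.

(* Set functions live on the open or closed sets only; they are represented by
   total functions that vanish elsewhere, so that Leibniz equality is equality
   on open and closed sets. *)
Definition topological_measure k mu : Prop :=
  [/\ forall A, 0 <= mu A,
      forall A, ~ (open A \/ closed A) -> mu A = 0
    & exists2 A, open A \/ closed A & mu A != +oo] /\
  [/\ forall A B, additive_pair k A B -> mu (A `|` B) = mu A + mu B,
      forall U, open U ->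
        mu U = ereal_sup [set mu K | K in [set K | compact K /\ K `<=` U]]
    & forall F, closed F ->
        mu F = ereal_inf [set mu U | U in [set U | open U /\ F `<=` U]]].

Definition finite_tm k mu : Prop := topological_measure k mu /\ mu setT < +oo.

Definition TM1 : set (set X -> \bar R) :=
  [set mu | topological_measure Plain mu /\ mu setT = 1].

Definition DTM1 : set (set X -> \bar R) :=
  [set mu | topological_measure Deficient mu /\ mu setT = 1].

Definition bounded_in_variation (M : set (set X -> \bar R)) : Prop :=
  exists2 C : R, (0 < C)%R & forall mu, M mu -> mu setT <= C%:E.

Definition point_mass (y : X) A : \bar R :=
  if `[< open A \/ closed A >] then (\1_A y)%:E else 0.

End topological_measures.

Section functions_and_integral.
Context {R : realType} {X : metricType R}.

Implicit Types (f : X -> R) (mu nu : set X -> \bar R) (k : kind).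

Definition C0 f : Prop :=
  continuous f /\ forall e : R, 0 < e -> compact [set x | e <= `|f x|].

Definition Cc f : Prop :=
  continuous f /\ compact (closure [set x | f x != 0]).

Definition Lip (s : R) f : Prop :=
  continuous f /\ forall x y, `|f x - f y| <= s * mdist x y.

(* [Lip_s(X,d)] intersected with [C_c(X)], resp. with [C_c^+(X)] *)
Definition Lip_c k (s : R) : set (X -> R) :=
  [set f | [/\ Lip s f, Cc f & k = Deficient -> forall x, 0 <= f x]].

Definition qint_on (a b : R) mu f : R :=
  (\int[lebesgue_measure]_(t in `[a, b]) fine (mu (f @^-1` `]t, +oo[)))
  + a * fine (mu setT).

(* The value of [qint_on a b mu f] does not depend on the interval [[a, b]]
   containing the range of [f]; the smallest one is used. *)
Definition qint mu f : R := qint_on (inf (range f)) (sup (range f)) mu f.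

(* Extended-real valued: on a compact space, signed constants are test functions
   and the supremum is infinite as soon as the total masses differ. *)
Definition dKR k mu nu : \bar R :=
  ereal_sup [set `|qint mu f - qint nu f|%:E | f in Lip_c k 1].

End functions_and_integral.

Section weak_topology.
Context {R : realType} {X : metricType R}.

Definition C0plus := {f : X -> R | C0 f /\ forall x, 0 <= f x}.

Definition integrals (mu : set X -> \bar R) : {ptws C0plus -> R} :=
  fun f => qint mu (sval f).

(* The finite deficient topological measures carry the subspace topology. *)
Definition weak_space := initial_topology integrals.

Definition simple_tm (k : kind) (mu : set X -> \bar R) : Prop :=
  topological_measure k mu /\ forall A, mu A = 0%E \/ mu A = 1%E.

Definition convex_hull (E : set (set X -> \bar R)) : set (set X -> \bar R) :=
  [set mu | exists (n : nat) (w : 'I_n -> R) (nu : 'I_n -> set X -> \bar R),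
    [/\ forall i, 0 <= w i, \sum_(i < n) w i = 1, forall i, E (nu i)
      & mu = (fun A => \sum_(i < n) (w i)%:E * nu i A)%E]].

Definition representable (k : kind) (mu : set X -> \bar R) : Prop :=
  finite_tm k mu /\
  closure (convex_hull (simple_tm k) : set weak_space) mu.

End weak_topology.

Section image_transformations.
Context {R : realType} {X : metricType R}.

Implicit Types (q : set X -> set X) (mu : set X -> \bar R) (k : kind).

(* Only the values of [q] on open and on compact sets are relevant. *)
Definition image_transformation k q : Prop :=
  [/\ (forall U, open U -> open (q U)) /\ (forall K, compact K -> compact (q K)),
      forall U, open U ->
        q U = \bigcup_(K in [set K | compact K /\ K `<=` U]) q K,
      forall K, compact K ->
        q K = \bigcap_(U in [set U | open U /\ K `<=` U]) q U
    & forall A B, additive_pair k A B ->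
        q A `&` q B = set0 /\ q (A `|` B) = q A `|` q B].

Definition adjoint q mu (A : set X) : \bar R :=
  if `[< open A \/ compact A >] then mu (q A)
  else if `[< closed A >] then
    ereal_inf [set mu (q U) | U in [set U | open U /\ A `<=` U]]
  else 0%E.

(* the (conic) quasi-homomorphism corresponding to [q] *)
Definition theta q (f : X -> R) (y : X) : R := qint (adjoint q (point_mass y)) f.

Definition contractivity_factor k q (s : R) : Prop :=
  0 < s < 1 /\ theta q @` Lip_c k 1 `<=` Lip_c k s.

Definition transformation_system k (q : nat -> set X -> set X)
    (alpha : nat -> R) : Prop :=
  [/\ forall i, image_transformation k (q i), forall i, 0 <= alpha i
    & (\sum_(0 <= i <oo) (alpha i)%:E <= 1)%E].

Definition system_contractivity_factor k (q : nat -> set X -> set X) (s : R) :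
    Prop :=
  forall i, exists2 si, contractivity_factor k (q i) si & si <= s.

Definition markov_operator (q : nat -> set X -> set X) (alpha : nat -> R) mu
    (A : set X) : \bar R :=
  (\sum_(0 <= i <oo) (alpha i)%:E * adjoint (q i) mu A)%E.

End image_transformations.

Section contractions.
Context {R : realType} {X : metricType R}.

Implicit Types (k : kind) (M : set (set X -> \bar R))
  (S : (set X -> \bar R) -> set X -> \bar R).

Definition dKR_contracting k M S : Prop :=
  exists2 c : R, 0 <= c < 1 & forall mu nu, M mu -> M nu ->
    (dKR k (S mu) (S nu) <= c%:E * dKR k mu nu)%E.

Definition fixed_in M S : set (set X -> \bar R) := [set mu | M mu /\ S mu = mu].

Definition dKR_finite k M : Prop :=
  forall mu nu, M mu -> M nu -> (dKR k mu nu < +oo)%E.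

(* closed in the space of all finite (deficient) topological measures *)
Definition dKR_closed k M : Prop :=
  forall mu, finite_tm k mu ->
    (forall e : R, 0 < e -> exists2 nu, M nu & (dKR k nu mu < e%:E)%E) -> M mu.

End contractions.

(* Main.v *)
(* Everything is read off the level sets of a test function. The identity
   [{theta f > t} = q {f > t}] for [t >= 0], and its analogue for sublevel sets
   when [t < 0], give [int f d(q^* mu) = int (theta f) dmu]; as [theta] maps
   [Lip_1] into [Lip_s], the Markov operator contracts [d_KR] by the factor [s].

   Uniqueness: a Lipschitz function squeezed between a compact set and an open
   neighbourhood of it shows that [d_KR] separates measures.

   Existence: the same functions show that a [d_KR]-Cauchy sequence satisfies
   [limsup mu_n K <= liminf mu_n U] for [K] compact inside [U] open, so that
   [mu U = sup_K liminf mu_n K], extended to closed sets from outside, is a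
   (deficient) topological measure. Convergence of the integrals follows since
   [mu_n {f > t}] and [mu {f > t}] interlace and are monotone in [t].

   Representability: the iterates of a point mass are countable convex
   combinations of simple measures, and they converge weakly to the fixed point. *)
Require Import Defs.
From mathcomp Require Import measurable_realfun ring lra.

Set Implicit Arguments.
Unset Strict Implicit.
Unset Printing Implicit Defensive.

Import Order.TTheory GRing.Theory Num.Theory.
Import numFieldNormedType.Exports.

Local Open Scope classical_set_scope.
Local Open Scope ring_scope.

(** * Compact sets and Lipschitz functions in a locally compact metric space *)

(** Three obstacles shape the argument. A quasi-integral need not be additive in the function; what
    remains is linearity in the measure and positive homogeneity in the function. So the series of
    measures is truncated, each adjoint is moved onto the test function, and its image under [theta]
    is rescaled to Lipschitz constant 1.

    Superlevel sets at negative levels are not relatively compact in general. There one passes to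
    the compact sublevel sets, which takes additivity on a compact and an open set, that is, the
    [Plain] case; in the [Deficient] case test functions are nonnegative and the negative levels
    cancel against the total mass.

    Mass may escape to infinity along a sequence, so limits are bounded from above on compact sets
    only, and the convergence of integrals must not rely on convergence of the total masses. Also
    [dKR] may be infinite, so all estimates are made with a real bound valid for every test
    function. *)

Lemma compact_directed_cover (T : topologicalType) (I : Type) (D : set I)
    (F : I -> set T) (K : set T) :
  compact K -> D !=set0 -> (forall i, D i -> open (F i)) ->
  (forall i j, D i -> D j -> exists2 l, D l & F i `|` F j `<=` F l) ->
  K `<=` \bigcup_(i in D) F i -> exists2 i, D i & K `<=` F i.
Proof.
move=> /compact_near_coveringP cK [i0 Di0] oF dirF KF.
(* [G] is generated by the upper ends of the directed family. Near-covering compactness then yields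
   an end whose members all contain [K], in particular its own index. *)
pose G := filter_from D (fun i => [set j | F i `<=` F j]).
have FG : Filter G.
  apply: filter_from_filter; first by exists i0.
  move=> i j Di Dj; have [l Dl Fl] := dirF i j Di Dj.
  exists l => // n /= Fn; split; apply: subset_trans Fn;
    apply: subset_trans Fl; [exact: subsetUl|exact: subsetUr].
have : forall x, K x -> \forall x' \near x & i \near G, F i x'.
  move=> x /KF[i Di Fx].
  exists (F i, [set j | F i `<=` F j]); last by move=> [y j] /= [Fy]; apply.
  split => /=; last by exists i.
  by apply: open_nbhs_nbhs; split => //; exact: oF.
move=> /(cK _ G _ FG)[i Di KFi]; exists i => //.
exact: (KFi i (@subset_refl _ (F i))).
Qed.

Section metric_topology.
Context {R : realType} {X : metricType R}.
Implicit Types (K U V C F : set X) (x y : X).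

Lemma metric_compact_closed K : compact K -> closed K.
Proof. by apply: compact_closed; exact: metric_hausdorff. Qed.

Lemma compact_setU_split K U V : compact K -> open U -> open V -> U `&` V = set0 ->
  K `<=` U `|` V -> exists K1 K2,
  [/\ compact K1, compact K2, K1 `<=` U, K2 `<=` V & K = K1 `|` K2].
Proof.
move=> cK oU oV UV KUV; exists (K `\` V), (K `\` U); split.
- by apply: compact_closedI => //; exact: open_closedC.
- by apply: compact_closedI => //; exact: open_closedC.
- by move=> x [/KUV[]].
- by move=> x [/KUV[]].
- apply/seteqP; split=> [x Kx|x [[]|[]]//].
  have [Ux|Vx] := KUV x Kx; [left|right]; split => //.
  + by move=> Vx; have : (U `&` V) x by []; rewrite UV.
  + by move=> Ux; have : (U `&` V) x by []; rewrite UV.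
Qed.

Lemma nbhs_mdistE x (A : set X) :
  nbhs x A <-> exists2 r : R, 0 < r & forall y, mdist x y < r -> A y.
Proof.
by split; rewrite -metricType_numDomainType.filter_from_mdist_nbhs.
Qed.

Lemma closed_mdist_ball x (r : R) : closed [set y | mdist x y <= r].
Proof.
rewrite -[X in closed X]setCK; apply: open_closedC; rewrite openE => y /=.
move=> /negP; rewrite -ltNge => ry; apply/nbhs_mdistE.
exists (mdist x y - r); first by rewrite subr_gt0.
move=> z yz /=; apply/negP; rewrite -ltNge.
have := metric_triangle x z y; rewrite [mdist z y]metric_sym; lra.
Qed.

Hypothesis X_loc_compact : locally_compact [set: X].

Lemma compact_mdist_ball x U : open U -> U x ->
  exists2 r : R, 0 < r & compact [set y | mdist x y <= r] /\
    [set y | mdist x y <= r] `<=` U.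
Proof.
move=> oU Ux; have [B] := X_loc_compact (x := x) I.
move=> xB [cB _].
have : nbhs x (B `&` U).
  apply: filterI; last exact: open_nbhs_nbhs.
  by apply: (@filterS _ (nbhs x) _ [set t | [set: X] t -> B t]) xB => y; apply.
move=> /nbhs_mdistE[r r0 BU]; exists (r / 2); first by lra.
have sBU y : mdist x y <= r / 2 -> (B `&` U) y by move=> xy; apply: BU; lra.
split; last by move=> y /sBU[].
apply: (subclosed_compact _ cB); first exact: closed_mdist_ball.
by move=> y /sBU[].
Qed.

Lemma compact_nbhd K U : compact K -> open U -> K `<=` U ->
  exists2 C, compact C /\ C `<=` U & K `<=` C°.
Proof.
move=> cK oU KU.
pose D := [set C : set X | compact C /\ C `<=` U].
have [||C C' [cC CU] [cC' C'U]|x Kx|C [cC CU] KC] :=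
  @compact_directed_cover X _ D (fun C => C°) K cK.
- by exists set0; split; [exact: compact0|exact: sub0set].
- by move=> C _; exact: open_interior.
- exists (C `|` C'); last exact: interiorU.
  by split; [exact: compactU|rewrite subUset].
- have [r r0 rU] := compact_mdist_ball oU (KU x Kx).
  exists [set y | mdist x y <= r] => //.
  by apply/nbhs_mdistE; exists r => // y; exact: ltW.
by exists C.
Qed.

(** One radius serves all of [K] because the sets on which a radius works grow as the radius
    shrinks. The compact [C] later confines the support of the test function built from this
    radius. *)
Lemma compact_mdist_nbhd K U : compact K -> open U -> K `<=` U ->
  exists2 r : R, 0 < r & exists2 C, compact C /\ C `<=` U &
    forall x y, K x -> mdist x y <= r -> C y.
Proof.
move=> cK oU KU; have [C CU KC] := compact_nbhd cK oU KU.
pose F (r : R) := [set x | forall y, mdist x y <= r -> C y].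
have [||r r' r0 r'0|x /KC /nbhs_mdistE[r r0 rC]|r r0 KF] :=
  @compact_directed_cover X _ [set r : R | 0 < r] (fun r => (F r)°) K cK.
- by exists 1 => /=.
- by move=> r _; exact: open_interior.
- exists (Num.min r r'); first by rewrite /= lt_min r0.
  apply: subset_trans (@interiorU _ _ _) _; apply: interiorS.
  by move=> x [] xC y; rewrite le_min => /andP[*]; apply: xC.
- exists (r / 3); first by rewrite /=; lra.
  apply/nbhs_mdistE; exists (r / 3); first by lra.
  by move=> y xy z yz; apply: rC; have := metric_triangle x y z; lra.
- exists r => //; exists C => // x y Kx; exact: (interior_subset (KF x Kx)).
Qed.

Definition mdist_set (K : set X) x : R := inf [set mdist x y | y in K].

Lemma mdist_set_lb K x y : K y -> mdist_set K x <= mdist x y.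
Proof.
move=> Ky; apply: ge_inf; last by exists y.
by exists 0 => _ [z _ <-]; exact: mdist_ge0.
Qed.

Lemma mdist_set_lip K x y : K !=set0 ->
  mdist_set K x <= mdist_set K y + mdist x y.
Proof.
move=> [z0 Kz0]; rewrite -lerBlDr; apply: lb_le_inf; first by exists (mdist y z0);
  exists z0.
move=> _ [z Kz <-]; have := mdist_set_lb x Kz; have := metric_triangle x y z.
by lra.
Qed.

Lemma mdist_set_lt K x (r : R) : K !=set0 -> mdist_set K x < r ->
  exists2 y, K y & mdist x y < r.
Proof.
move=> [z0 Kz0] xr.
have [|_ [y Ky <-] yr] := @inf_lt R [set mdist x y | y in K] r _ xr.
by exists (mdist x z0), z0.
by exists y.
Qed.

Lemma lip_continuous (f : X -> R) (s : R) :
  (forall x y, `|f x - f y| <= s * mdist x y) -> continuous f.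
Proof.
move=> fL x; apply/cvgrPdist_lt => e e0; apply/nbhs_mdistE.
exists (e / (`|s| + 1)); first by rewrite divr_gt0// ltr_wpDl.
move=> y; rewrite ltr_pdivlMr ?ltr_wpDl// => xy; apply: le_lt_trans (fL x y) _.
apply: le_lt_trans xy; rewrite mulrC ler_wpM2l ?mdist_ge0//.
by rewrite (le_trans (ler_norm s))// lerDl.
Qed.

Lemma Lip_c_cst0 k : Lip_c k 1 (cst 0 : X -> R).
Proof.
split; [split|split|by []].
- exact: cst_continuous.
- by move=> x y; rewrite subrr normr0 mul1r mdist_ge0.
- exact: cst_continuous.
- rewrite (_ : [set x | _] = set0) ?closure0; first exact: compact0.
  by apply/seteqP; split => x //=; rewrite eqxx.
Qed.

(** The function falls off with the distance to [K]. Its height is the uniform radius [r] instead of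
    1 because the slope must stay at most 1. *)
Lemma lip_urysohn k K U : compact K -> open U -> K `<=` U ->
  exists (f : X -> R) (r : R), [/\ 0 < r, Lip_c k 1 f,
    forall x, 0 <= f x <= r, forall x, K x -> f x = r &
    forall x, 0 < f x -> U x].
Proof.
(* For empty [K] the distance takes the default value 0 of [inf], and the general formula would give
   the constant [r]. *)
move=> cK oU KU; have [K0|/set0P[z Kz]] := eqVneq K set0.
  exists (cst 0), 1; split => //=.
  - exact: Lip_c_cst0.
  - by move=> x; rewrite lexx ler01.
  - by move=> x; rewrite K0.
  - by move=> x; rewrite ltxx.
have Kn0 : K !=set0 by exists z.
have [r r0 [C [cC CU] KC]] := compact_mdist_nbhd cK oU KU.
pose f x := Num.max 0 (r - mdist_set K x).
have f_lip x y : `|f x - f y| <= 1 * mdist x y.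
  have := mdist_set_lip x y Kn0; have := mdist_set_lip y x Kn0.
  rewrite [mdist y x]metric_sym mul1r /f => h1 h2; have := mdist_ge0 x y.
  by rewrite ler_norml; case: (leP 0 (r - mdist_set K x)) => ?;
    case: (leP 0 (r - mdist_set K y)) => ? ?; apply/andP; split; lra.
have f_cts := lip_continuous f_lip.
have fC x : f x != 0 -> C x.
  move=> xr; have {}xr : mdist_set K x < r.
    rewrite ltNge; apply/negP => rx; move/eqP: xr; apply.
    by rewrite /f; apply/max_idPl; lra.
  by have [y Ky xy] := mdist_set_lt Kn0 xr; apply: (KC y) => //; rewrite metric_sym ltW.
have dist0 x : 0 <= mdist_set K x.
  by apply: lb_le_inf; [exists (mdist x z), z|move=> _ [y _ <-]; exact: mdist_ge0].
exists f, r; split => //.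
- split => //; last by move=> _ x; rewrite /f le_max lexx.
  split => //; apply: (subclosed_compact _ cC); first exact: closed_closure.
  by rewrite [X in _ `<=` X](closure_id _).1; [exact: closureS|exact:
    metric_compact_closed].
- by move=> x; rewrite /f le_max lexx ge_max (ltW r0) lerBlDr lerDl dist0.
- move=> x Kx; have := mdist_set_lb x Kx; rewrite mdistxx => h.
  have xK : mdist_set K x = 0 by apply/eqP; rewrite eq_le h dist0.
  by rewrite /f xK subr0; apply/max_idPr; exact: ltW.
- by move=> x fx; apply: CU; apply: fC; rewrite gt_eqF.
Qed.

Lemma C0_bounded (f : X -> R) : C0 f -> exists2 C : R, 0 < C & forall x, `|f x| <= C.
Proof.
move=> [cf /(_ 1 ltr01) cK].
have /compact_bounded[M [_ MK]] : compact (f @` [set x | 1 <= `|f x|]).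
  by apply: continuous_compact => //; exact: continuous_subspaceT.
exists (Num.max 1 (M + 1)); first by rewrite lt_max ltr01.
move=> x; rewrite le_max; have [fx|/ltW ->//] := leP 1 `|f x|; apply/orP; right.
by apply: (MK (M + 1)); [rewrite ltrDl|exists x].
Qed.

Lemma Cc_C0 (f : X -> R) : Cc f -> C0 f.
Proof.
move=> [cf cK]; split=> // e e0; apply: (subclosed_compact _ cK).
  apply: (@preimage_closed _ _ (fun x => `|f x|) [set t | e <= t]); last exact: closed_ge.
  by move=> x _; apply: cvg_norm; exact: cf.
by move=> x /= ex; apply: subset_closure => /=; rewrite -normr_gt0; lra.
Qed.

End metric_topology.

(** * Integrals of monotone functions *)

Section monotone_integrals.
Context {R : realType}.
Implicit Types (g u v : R -> R) (a b c h : R).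

Local Notation J g a b := (\int[lebesgue_measure]_(t in `[a, b]) g t).
Local Notation itg g a b :=
  ((@lebesgue_measure R).-integrable `[a, b] (EFin \o g)).

Lemma nonincreasing_integrable g a b : nonincreasing_fun g -> itg g a b.
Proof.
move=> gd; apply: measurable_bounded_integrable => //.
- by rewrite /= lebesgue_measure_itv/=; case: ifP => // _; rewrite -EFinB ltry.
- exact: nonincreasing_measurable.
- exists (Num.max `|g a| `|g b|); split; first exact: num_real.
  move=> M gM t /=; rewrite in_itv/= => /andP[/gd ga /gd gb].
  apply/ltW/(le_lt_trans _ gM); rewrite ler_norml lerNl !le_max.
  have := ler_norm (g a); have := ler_norm (- g b); rewrite normrN.
  by move=> h1 h2; apply/andP; split; apply/orP; [right|left]; lra.
Qed.

Lemma integral_itv_cst a b c : a <= b -> J (fun=> c) a b = (b - a) * c.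
Proof.
move=> ab; rewrite Rintegral_cst//= lebesgue_measure_itv/= lte_fin mulrC.
by case: ltgtP ab => // -> _; rewrite subrr mul0r.
Qed.

Lemma integral_itv_split g a b c : a <= b -> b <= c -> itg g a c ->
  J g a c = J g a b + J g b c.
Proof.
move=> ab bc ig; have /= := Rintegral_itvB (x := b) ig.
rewrite !bnd_simp => /(_ ab bc) h.
rewrite -[LHS](subrK (J g a b)) h addrC Rintegral_itv_obnd_cbnd//.
by apply: integrableS ig => //; apply: subset_itv; rewrite bnd_simp.
Qed.

Lemma integral_itv_le u v a b : itg u a b -> itg v a b ->
  (forall t, a <= t <= b -> u t <= v t) -> J u a b <= J v a b.
Proof. by move=> iu iv uv; apply: le_Rintegral. Qed.

(** The right end is a null set. It must be left out in [qint_sandwich], where the superlevel set at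
    the maximal height is empty and the comparison can fail. *)
Lemma integral_itvco_le u v a b : itg u a b -> itg v a b ->
  (forall t, a <= t < b -> u t <= v t) -> J u a b <= J v a b.
Proof.
move=> iu iv uv.
have s : [set` `[a, b[] `<=` [set` `[a, b]] by apply: subset_itvl; rewrite bnd_simp.
rewrite -!Rintegral_itv_bndo_bndc; [|exact: integrableS iv|exact: integrableS iu] => //.
by apply: le_Rintegral => //; [exact: integrableS iu|exact: integrableS iv].
Qed.

Lemma integral_itv_point g a : J g a a = 0.
Proof. by rewrite set_itv1 Rintegral_set1. Qed.

Lemma eq_integral_itvco u v a b : itg u a b -> itg v a b ->
  (forall t, a <= t < b -> u t = v t) -> J u a b = J v a b.
Proof.
move=> iu iv uv.
have s : [set` `[a, b[] `<=` [set` `[a, b]] by apply: subset_itvl; rewrite bnd_simp.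
rewrite -!Rintegral_itv_bndo_bndc; [|exact: integrableS iv|exact: integrableS iu] => //.
by apply: eq_Rintegral => t; rewrite inE/= in_itv/=; exact: uv.
Qed.

Lemma cst_integrable_itv a b c : itg (fun=> c) a b.
Proof. exact: nonincreasing_integrable. Qed.

Lemma integral_itv_bounds g a b l r : a <= b -> itg g a b ->
  (forall t, a <= t <= b -> l <= g t <= r) ->
  (b - a) * l <= J g a b <= (b - a) * r.
Proof.
move=> ab ig glr; rewrite -!integral_itv_cst//.
by apply/andP; split; apply: integral_itv_le => //; (try exact: cst_integrable_itv);
  move=> t /glr /andP[].
Qed.

Lemma integrable_itvB u v a b : itg u a b -> itg v a b ->
  itg (fun t => u t - v t) a b.
Proof.
move=> iu iv; have iuv := integrableB _ iu iv.
by apply: eq_integrable (iuv _) => // t _; rewrite /= EFinB.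
Qed.

Lemma integral_itv_close u v a b e : a <= b -> itg u a b -> itg v a b ->
  (forall t, a <= t <= b -> `|u t - v t| <= e) ->
  `|J u a b - J v a b| <= (b - a) * e.
Proof.
move=> ab iu iv uv; rewrite -RintegralB// ler_norml -mulrN.
apply: integral_itv_bounds => //; last by move=> t /uv; rewrite ler_norml.
exact: integrable_itvB.
Qed.

Lemma nonincreasing_Riemann_sum g a h (n : nat) : nonincreasing_fun g -> 0 <= h ->
  h * \sum_(k < n) g (a + k.+1%:R * h) <= J g a (a + n%:R * h)
    <= h * \sum_(k < n) g (a + k%:R * h).
Proof.
move=> gd h0; elim: n => [|n /andP[IHl IHr]].
  by rewrite !big_ord0 mulr0 mul0r addr0 integral_itv_point lexx.
have e : a + n.+1%:R * h = a + n%:R * h + h by rewrite -natr1; ring.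
have nh : 0 <= n%:R * h by rewrite mulr_ge0.
rewrite (@integral_itv_split _ _ (a + n%:R * h)); last 3 first.
- by rewrite lerDl.
- by rewrite e lerDl.
- exact: nonincreasing_integrable.
rewrite !big_ord_recr/= !mulrDr.
have hd : a + n.+1%:R * h - (a + n%:R * h) = h by rewrite e; ring.
have le_h : a + n%:R * h <= a + n.+1%:R * h by rewrite e lerDl.
have gh t : a + n%:R * h <= t <= a + n.+1%:R * h ->
    g (a + n.+1%:R * h) <= g t <= g (a + n%:R * h).
  by move=> /andP[/gd -> /gd ->].
have /andP[] := integral_itv_bounds le_h (nonincreasing_integrable _ _ gd) gh.
rewrite hd => l1 l2.
by apply/andP; split; apply: lerD.
Qed.

(** The upper sum of [u] uses the nodes 0 to [n.+1], the lower sum of [v] the nodes 1 to [n.+2].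
    Comparing node [k.+2] of [u] with node [k.+1] of [v] leaves two terms of each sum unmatched;
    these four account for [4 * B]. *)
Lemma Riemann_sum_le u v a h (n : nat) (B e : R) :
  nonincreasing_fun u -> nonincreasing_fun v -> 0 <= h -> 0 <= e ->
  (forall t, a <= t <= a + n.+2%:R * h -> `|u t| <= B /\ `|v t| <= B) ->
  (forall k, (k < n)%N -> u (a + k.+2%:R * h) <= v (a + k.+1%:R * h) + e) ->
  J u a (a + n.+2%:R * h) <=
    J v a (a + n.+2%:R * h) + h * (4 * B) + n.+2%:R * h * e.
Proof.
move=> ud vd h0 e0 uvB uv.
have /andP[_ /le_trans] := nonincreasing_Riemann_sum a n.+2 ud h0; apply.
have /andP[vl _] := nonincreasing_Riemann_sum a n.+2 vd h0.
rewrite -addrA -(lerD2r (h * (4 * B) + n.+2%:R * h * e)) in vl *.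
apply: le_trans vl; rewrite [n.+2%:R * h]mulrC -!mulrA -!mulrDr.
have B1 (k : nat) : (k <= n.+2)%N -> a <= a + k%:R * h <= a + n.+2%:R * h.
  by move=> kn; rewrite lerDl mulr_ge0//= lerD2l ler_wpM2r// ler_nat.
apply: ler_wpM2l => //.
rewrite 2!big_ord_recl [X in _ <= X + _]big_ord_recr [X in _ <= X + _ +
  _]big_ord_recr /=.
have [u0 _] := uvB _ (B1 0%N isT); have [u1 _] := uvB _ (B1 1%N isT).
have [_ v0] := uvB _ (B1 n.+1 (leqnSn _)); have [_ v1] := uvB _ (B1 n.+2 (leqnn _)).
move: u0 u1 v0 v1; rewrite !ler_norml => /andP[_ u0] /andP[_ u1] /andP[v0 _] /andP[v1
  _].
suff : \sum_(i < n) u (a + (bump 0 (bump 0 i))%:R * h) <=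
    \sum_(i < n) v (a + i.+1%:R * h) + n.+2%:R * e.
  move=> H; rewrite /bump/= in H u0 u1 *; lra.
apply: (@le_trans _ _ (\sum_(i < n) (v (a + i.+1%:R * h) + e))).
  by apply: ler_sum => i _; exact: uv.
rewrite big_split/= lerD2l sumr_const card_ord -[leLHS]mulr_natl.
by rewrite ler_wpM2r// ler_nat ltnW.
Qed.

(** The nodes for [g (t / c)] rescale to those for [g], so both sides lie between the same lower and
    upper sums. Their gap telescopes to [c * h * (g a - g b)] and vanishes with the mesh. *)
Lemma nonincreasing_integral_scale g a b c : a <= b -> 0 < c ->
  nonincreasing_fun g ->
  J (fun t => g (t / c)) (c * a) (c * b) = c * J g a b.
Proof.
move=> ab c0 gd; set x := LHS; set y := RHS.
have gcd : nonincreasing_fun (fun t => g (t / c)).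
  by move=> s t st; apply: gd; rewrite ler_pM2r ?invr_gt0.
suff H (n : nat) : `|x - y| <= c * (b - a) * (g a - g b) / n.+1%:R.
  apply/eqP; rewrite -subr_eq0 -normr_le0; apply/ler_addgt0Pl => e e0; rewrite addr0.
  pose z := c * (b - a) * (g a - g b).
  have z0 : 0 <= z by rewrite !mulr_ge0 ?subr_ge0 ?gd// ltW.
  apply: le_trans (H (Num.truncn (z / e))) _; rewrite -/z ler_pdivrMr// mulrC
    -ler_pdivrMr//.
  by apply/ltW; apply: truncnS_gt.
pose h := (b - a) / n.+1%:R.
have h0 : 0 <= h by rewrite divr_ge0// subr_ge0.
have bE : a + n.+1%:R * h = b by rewrite /h; field; rewrite addrC natr1.
have := nonincreasing_Riemann_sum a n.+1 gd h0; rewrite bE => /andP[gl gr].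
have := nonincreasing_Riemann_sum (c * a) n.+1 gcd (mulr_ge0 (ltW c0) h0).
have -> : c * a + n.+1%:R * (c * h) = c * b by rewrite -bE; ring.
rewrite -/x; have E (k : nat) : (c * a + k%:R * (c * h)) / c = a + k%:R * h.
  by field; rewrite gt_eqF.
under eq_bigr do rewrite E.
under [X in _ <= _ * X]eq_bigr do rewrite E.
move=> /andP[xl xr].
have := ler_wpM2l (ltW c0) gl; have := ler_wpM2l (ltW c0) gr; rewrite -/y => yr yl.
have {}E : \sum_(k < n.+1) g (a + k%:R * h) - \sum_(k < n.+1) g (a + k.+1%:R * h) = g
  a - g b.
  rewrite big_ord_recl [X in _ - X]big_ord_recr/= bE mul0r addr0.
  by rewrite /bump/=; ring.
have -> : c * (b - a) * (g a - g b) / n.+1%:R = c * h * (g a - g b) by rewrite /h; ring.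
rewrite -E mulrBr ler_norml; move: yl yr; rewrite ![c * (h * _)]mulrA => yl yr.
by apply/andP; split; lra.
Qed.

(** Pointwise convergence may fail at the jumps of [g], so the hypothesis only interlaces values at
    distinct points. With the partition fixed beforehand it is used for finitely many pairs of
    neighbouring nodes. *)
Lemma nonincreasing_integral_cvg (g_ : nat -> R -> R) g a b (B : R) :
  a < b -> (forall n, nonincreasing_fun (g_ n)) -> nonincreasing_fun g ->
  (forall n t, `|g_ n t| <= B) -> (forall t, `|g t| <= B) ->
  (forall s t, a < s -> s < t -> t < b -> forall e, 0 < e ->
    \forall n \near \oo, g_ n t <= g s + e /\ g t <= g_ n s + e) ->
  forall e, 0 < e -> \forall n \near \oo, `|J (g_ n) a b - J g a b| <= e.
Proof.
move=> ab gd_ gd gB_ gB gg e e0.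
have B0 : 0 <= B by apply: le_trans (gB 0).
pose M := (b - a) * (4 * B).
(* This makes the boundary error [h * (4 * B)] at most [e / 2]; the tolerance [d] below spreads the
   other half over the interval. *)
pose n := Num.truncn (M / (e / 2)).
pose h := (b - a) / n.+2%:R.
have h0 : 0 < h by rewrite divr_gt0 ?subr_gt0.
have bE : a + n.+2%:R * h = b by rewrite /h mulrC divfK ?pnatr_eq0// addrC subrK.
have hM : h * (4 * B) <= e / 2.
  have -> : h * (4 * B) = M / n.+2%:R by rewrite /h /M; ring.
  rewrite ler_pdivrMr// mulrC -ler_pdivrMr ?divr_gt0//.
  apply: (le_trans (ltW (truncnS_gt _))); rewrite -/n ler_nat.
  by rewrite ltnW.
have bE' : n.+2%:R * h = b - a by rewrite -bE; ring.
pose d := e / 2 / (b - a).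
have d0 : 0 < d by rewrite !divr_gt0// subr_gt0.
have : \forall m \near \oo, forall k : 'I_n,
    g_ m (a + k.+2%:R * h) <= g (a + k.+1%:R * h) + d /\
    g (a + k.+2%:R * h) <= g_ m (a + k.+1%:R * h) + d.
  apply: filter_forall => k; apply: gg => //.
  - by rewrite ltrDl mulr_gt0.
  - by rewrite ltrD2l ltr_pM2r// ltr_nat.
  - by rewrite -bE ltrD2l ltr_pM2r// ltr_nat !ltnS.
apply: filterS => m gm.
have l1 := @Riemann_sum_le (g_ m) g a h n B d (gd_ m) gd (ltW h0) (ltW d0)
  (fun t _ => conj (gB_ m t) (gB t)) (fun k kn => (gm (Ordinal kn)).1).
have l2 := @Riemann_sum_le g (g_ m) a h n B d gd (gd_ m) (ltW h0) (ltW d0)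
  (fun t _ => conj (gB t) (gB_ m t)) (fun k kn => (gm (Ordinal kn)).2).
have dE : n.+2%:R * h * d = e / 2.
  by rewrite bE' /d mulrC divfK// gt_eqF// subr_gt0.
rewrite bE dE in l1 l2; rewrite ler_norml; apply/andP; split; lra.
Qed.

End monotone_integrals.

(** * Finite topological measures *)

Section real_topological_measures.
Context {R : realType} {X : metricType R}.
Implicit Types (m : set X -> R) (A B K U F : set X) (k : kind) (q : set X -> set X).

(* The real-valued form of [finite_tm]: (TM2) and (TM3) become approximations
   up to [e], and monotonicity, which they imply, is recorded as a field. *)
Record rtm k m : Prop := Rtm {
  rtm_ge0 : forall A, 0 <= m A;
  rtm_out : forall A, ~ (open A \/ closed A) -> m A = 0;
  rtm_le : forall A B, open A \/ closed A -> open B \/ closed B ->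
    A `<=` B -> m A <= m B;
  rtm_add : forall A B, additive_pair k A B -> m (A `|` B) = m A + m B;
  rtm_inner : forall U e, open U -> 0 < e ->
    exists2 K, compact K /\ K `<=` U & m U < m K + e;
  rtm_outer : forall F e, closed F -> 0 < e ->
    exists2 U, open U /\ F `<=` U & m U < m F + e }.

Lemma open_or_compact_closed A : open A \/ compact A -> open A \/ closed A.
Proof. by move=> [|/metric_compact_closed]; [left|right]. Qed.

Lemma additive_pair_open_or_closed k A B : additive_pair k A B ->
  [/\ open A \/ closed A, open B \/ closed B & open (A `|` B) \/ closed (A `|` B)].
Proof.
case: k => -[_].
  by move=> [oA oB oAB]; split; exact: open_or_compact_closed.
by move=> [cA cB]; split; apply: open_or_compact_closed; right => //; exact: compactU.
Qed.

Lemma additive_pair_compact k A B : compact A -> compact B -> A `&` B = set0 ->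
  additive_pair k A B.
Proof.
move=> cA cB AB; split=> //; case: k; last by [].
by split; right => //; exact: compactU.
Qed.

Lemma topological_measure_le k (mu : set X -> \bar R) A B :
  topological_measure k mu -> open A \/ closed A -> open B \/ closed B ->
  A `<=` B -> (mu A <= mu B)%E.
Proof.
move=> [_ [_ TM2 TM3]].
have oo U V : open U -> open V -> U `<=` V -> (mu U <= mu V)%E.
  move=> oU oV UV; rewrite (TM2 U oU) (TM2 V oV); apply/ereal_supP => _ [K [cK KU] <-].
  by apply: ereal_sup_ubound; exists K => //; split => //; exact: subset_trans UV.
have co F U : closed F -> open U -> F `<=` U -> (mu F <= mu U)%E.
  by move=> cF oU FU; rewrite (TM3 F cF); apply: ereal_inf_lbound; exists U.
have cl A' F : closed F -> (forall U, open U -> F `<=` U -> (mu A' <= mu U)%E) -> (mu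
  A' <= mu F)%E.
  by move=> cF AU; rewrite (TM3 F cF); apply/ereal_infP => _ [U [oU FU] <-]; exact: AU.
move=> [oA|cA] [oB|cB] AB; [exact: oo| |exact: co|].
- by apply: cl => // U oU BU; apply: oo => //; exact: subset_trans BU.
- by apply: cl => // U oU BU; apply: co => //; exact: subset_trans BU.
Qed.

(** Monotonicity bounds every value by the finite total mass, so [fine] loses nothing and later
    estimates are real arithmetic. *)
Lemma finite_tmP k (mu : set X -> \bar R) : finite_tm k mu <->
  exists2 m, rtm k m & mu = EFin \o m.
Proof.
have oT : open [set: X] \/ closed [set: X] by left; exact: openT.
split=> [[tm fin]|[m [m0 mout mle madd minn mout'] ->]].
  have [[mu0 muout _] [TM1 TM2 TM3]] := tm.
  have muE A : mu A = (fine (mu A))%:E.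
    rewrite fineK// ge0_fin_numE//.
    have [oA|/muout -> //] := pselect (open A \/ closed A).
    exact: le_lt_trans (topological_measure_le tm oA oT (@subsetT _ A)) fin.
  exists (fine \o mu); last by apply/funext => A /=; exact: muE.
  split => /=.
  - by move=> A; exact: fine_ge0.
  - by move=> A /muout ->.
  - by move=> A B oA oB AB; rewrite -lee_fin -!muE;
      exact: topological_measure_le tm oA oB AB.
  - by move=> A B AB; rewrite TM1// [mu A]muE [mu B]muE.
  - move=> U e oU e0.
    have : (mu U - e%:E < mu U)%E by rewrite [mu U]muE lteBlDr// lte_fin ltrDl.
    rewrite {2}(TM2 U oU) => /ereal_sup_gt[_ [K KU <-]] h; exists K => //.
    by move: h; rewrite [mu U]muE [mu K]muE lteBlDr.
  - move=> F e oF e0.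
    have : (mu F < mu F + e%:E)%E by rewrite [mu F]muE lte_fin ltrDl.
    rewrite {1}(TM3 F oF) => /ereal_inf_lt[_ [U KU <-]] h; exists U => //.
    by move: h; rewrite [mu U]muE [mu F]muE.
split; last by rewrite /= ltry.
split; split => /=.
- by move=> A; rewrite lee_fin.
- by move=> A /mout ->.
- by exists setT.
- by move=> A B AB; rewrite madd.
- move=> U oU; apply/eqP; rewrite eq_le; apply/andP; split; last first.
    apply/ereal_supP => _ [K [cK KU] <-]; rewrite lee_fin; apply: mle => //;
      last by left.
    by right; exact: metric_compact_closed.
  apply/lee_addgt0Pr => e e0; have [K KU UK] := minn U e oU e0.
  apply: (@le_trans _ _ ((m K)%:E + e%:E)%E); first by rewrite lee_fin ltW.
  by rewrite leeD2r//; apply: ereal_sup_ubound; exists K.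
- move=> F cF; apply/eqP; rewrite eq_le; apply/andP; split.
    apply/ereal_infP => _ [U [oU FU] <-]; rewrite lee_fin; apply: mle => //;
      first by right.
    by left.
  apply/lee_addgt0Pr => e e0; have [U FU UF] := mout' F e cF e0.
  apply: (@le_trans _ _ (m U)%:E); last by rewrite lee_fin ltW.
  by apply: ereal_inf_lbound; exists U.
Qed.

Lemma rtm_Deficient k m : rtm k m -> rtm Deficient m.
Proof.
move=> [m0 mo ml ma mi mO]; split => // A B [AB [cA cB]]; apply: ma.
exact: additive_pair_compact.
Qed.

Lemma rtm_set0 k m : rtm k m -> m set0 = 0.
Proof.
move=> rm; have := rtm_add rm (additive_pair_compact k compact0 compact0 (setI0 _)).
by rewrite setU0 => /eqP; rewrite addrC -subr_eq subrr eq_sym => /eqP.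
Qed.

Lemma rtm_leT k m A : rtm k m -> m A <= m setT.
Proof.
move=> rm; have [oA|/(rtm_out rm) ->] := pselect (open A \/ closed A).
  by apply: (rtm_le rm) => //; left; exact: openT.
exact: rtm_ge0 rm _.
Qed.

Lemma rtm_openU m U V : rtm Deficient m -> open U -> open V -> U `&` V = set0 ->
  m (U `|` V) <= m U + m V.
Proof.
move=> rm oU oV UV; apply/ler_addgt0Pr => e e0.
have [K [cK KUV] Ke] := rtm_inner rm (openU oU oV) e0.
have [K1 [K2 [cK1 cK2 KU KV KE]]] := compact_setU_split cK oU oV UV KUV.
have KI : K1 `&` K2 = set0 by rewrite -subset0 -UV; exact: setISS.
rewrite KE (rtm_add rm (additive_pair_compact _ cK1 cK2 KI)) in Ke.
apply/ltW/(lt_le_trans Ke); rewrite lerD2r lerD//; apply: (rtm_le rm) => //;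
  by [left|right; exact: metric_compact_closed].
Qed.

Lemma rtm_inner_compact k m A e : rtm k m -> open A \/ compact A -> 0 < e ->
  exists2 K, compact K /\ K `<=` A & m A < m K + e.
Proof.
move=> rm [oA|cA] e0; first exact: rtm_inner rm _ _ oA e0.
by exists A; [split => //; exact: subset_refl|rewrite ltrDl].
Qed.

Lemma rtm_superadd m A B : rtm Deficient m -> open A \/ compact A ->
  open B \/ compact B -> open (A `|` B) \/ closed (A `|` B) ->
  A `&` B = set0 -> m A + m B <= m (A `|` B).
Proof.
move=> rm oA oB oAB AB; apply/ler_addgt0Pr => e e0.
have e2 : 0 < e / 2 by lra.
have [K [cK KA] Ke] := rtm_inner_compact rm oA e2.
have [L [cL LB] Le] := rtm_inner_compact rm oB e2.
have KL : K `&` L = set0 by rewrite -subset0 -AB; exact: setISS.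
have := rtm_le rm (or_intror (metric_compact_closed (compactU cK cL))) oAB (setUSS KA
  LB).
rewrite (rtm_add rm (additive_pair_compact _ cK cL KL)); lra.
Qed.

(** Superadditivity and subadditivity on two disjoint open sets already follow from inner
    regularity. What is left for [Plain] is the upper bound for a compact set and a disjoint open
    one, and this is the form in which limits can be checked. *)
Lemma rtm_Plain m : rtm Deficient m ->
  (forall K U, compact K -> open U -> K `<=` U -> m U <= m K + m (U `\` K)) ->
  rtm Plain m.
Proof.
move=> rm mKU; have [m0 mo ml ma mi mO] := rm; split => // A B AB.
have [oA' oB' oAB'] := additive_pair_open_or_closed AB.
have {AB} [AB [oA oB oAB]] := AB.
apply/eqP; rewrite eq_le (rtm_superadd rm) ?andbT//.
suff H C U : compact C -> open U -> C `&` U = set0 -> open (C `|` U) \/ compact (C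
  `|` U) ->
    m (C `|` U) <= m C + m U.
  case: oA oB => [oA|cA] [oB|cB]; [exact: rtm_openU| | exact: H|].
  - by rewrite setUC addrC; apply: H => //; rewrite 1?setIC 1?setUC.
  - by rewrite ma.
move=> cC oU CU.
have UE V : C `|` U `<=` V -> V `\` C = U `|` (V `\` (C `|` U)).
  move=> CUV; apply/seteqP; split => [x [Vx nC]|x [Ux|[Vx nCU]]].
  - by have [Ux|nU] := pselect (U x); [left|right; split => // -[]].
  - split; first by apply: CUV; right.
    by move=> Cx; have : (C `&` U) x by []; rewrite CU.
  - by split => // Cx; apply: nCU; left.
move=> [oCU|cCU].
  by have := mKU C _ cC oCU (@subsetUl _ _ _); rewrite UE// setDv setU0.
(* The union is now compact, perhaps not open. The hypothesis is applied in the whole space instead,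
   and the finite mass of the complement of the union cancels. *)
have clCU := metric_compact_closed cCU.
have oT : open ([set: X] `\` (C `|` U)) by apply: openI;
  [exact: openT|exact: closed_openC].
have h1 := mKU C setT cC openT (@subsetT _ _).
rewrite UE// in h1.
have h2 : m (U `|` ([set: X] `\` (C `|` U))) <= m U + m ([set: X] `\` (C `|` U)).
  apply: rtm_openU => //; rewrite -subset0 => x [Ux [_ +]]; apply; by right.
have h3 : m (C `|` U) + m ([set: X] `\` (C `|` U)) <= m setT.
  have E : (C `|` U) `|` ([set: X] `\` (C `|` U)) = setT.
    by rewrite setTD setUv.
  rewrite -[in leRHS]E; apply: rtm_superadd => //; [by right|by left|rewrite E; left;
    exact: openT|].
  by rewrite setTD setICr.
lra.
Qed.

(** Outer regularity carries monotonicity from open to closed targets, so only comparisons with open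
    sets have to be checked. *)
Lemma rtm_open_intro k m : (forall A, 0 <= m A) ->
  (forall A, ~ (open A \/ closed A) -> m A = 0) ->
  (forall U V, open U -> open V -> U `<=` V -> m U <= m V) ->
  (forall F U, closed F -> open U -> F `<=` U -> m F <= m U) ->
  (forall A B, additive_pair k A B -> m (A `|` B) = m A + m B) ->
  (forall U e, open U -> 0 < e ->
    exists2 K, compact K /\ K `<=` U & m U < m K + e) ->
  (forall F e, closed F -> 0 < e ->
    exists2 U, open U /\ F `<=` U & m U < m F + e) -> rtm k m.
Proof.
move=> m0 mo oo co ma mi mO; split => // A B.
have cl A' F : closed F -> (forall U, open U -> F `<=` U -> m A' <= m U) -> m A' <= m F.
  move=> cF AU; apply/ler_addgt0Pr => e e0; have [U [oU FU] /ltW] := mO F e cF e0.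
  by apply: le_trans; exact: AU.
move=> [oA|cA] [oB|cB] AB; [exact: oo| |exact: co|].
- by apply: cl => // U oU BU; apply: oo => //; exact: subset_trans BU.
- by apply: cl => // U oU BU; apply: co => //; exact: subset_trans BU.
Qed.

Lemma rtm_cst0 k : rtm k (fun=> 0).
Proof.
split => //.
- by move=> A B _; rewrite addr0.
- by move=> U e _ e0; exists set0; [split; [exact: compact0|exact: sub0set]|rewrite
    add0r].
- by move=> F e _ e0; exists setT; [split; [exact: openT|exact: subsetT]|rewrite add0r].
Qed.

Lemma rtmD k m1 m2 : rtm k m1 -> rtm k m2 -> rtm k (fun A => m1 A + m2 A).
Proof.
move=> r1 r2; split.
- by move=> A; rewrite addr_ge0 ?(rtm_ge0 r1) ?(rtm_ge0 r2).
- by move=> A nA; rewrite (rtm_out r1)// (rtm_out r2)// addr0.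
- by move=> A B oA oB AB; rewrite lerD ?(rtm_le r1)// (rtm_le r2).
- by move=> A B AB; rewrite (rtm_add r1)// (rtm_add r2)//; ring.
- move=> U e oU e0; have e2 : 0 < e / 2 by lra.
  have [K [cK KU] Ke] := rtm_inner r1 oU e2.
  have [L [cL LU] Le] := rtm_inner r2 oU e2.
  have cKL := compactU cK cL.
  exists (K `|` L); first by split => //; rewrite subUset.
  have oKL : open (K `|` L) \/ closed (K `|` L) by right; exact: metric_compact_closed.
  have := rtm_le r1 (or_intror (metric_compact_closed cK)) oKL (@subsetUl _ K L).
  have := rtm_le r2 (or_intror (metric_compact_closed cL)) oKL (@subsetUr _ K L).
  lra.
- move=> F e oF e0; have e2 : 0 < e / 2 by lra.
  have [U [oU FU] Ue] := rtm_outer r1 oF e2.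
  have [V [oV FV] Ve] := rtm_outer r2 oF e2.
  exists (U `&` V); first by split; [exact: openI|rewrite subsetI].
  have := rtm_le r1 (or_introl (openI oU oV)) (or_introl oU) (@subIsetl _ U V).
  have := rtm_le r2 (or_introl (openI oU oV)) (or_introl oV) (@subIsetr _ U V).
  lra.
Qed.

Lemma rtmZ k c m : 0 <= c -> rtm k m -> rtm k (fun A => c * m A).
Proof.
rewrite le_eqVlt => /predU1P[<-|c0] r.
  by rewrite (_ : (fun A => 0 * m A) = fun=> 0); [exact: rtm_cst0|apply/funext => A;
    rewrite mul0r].
split.
- by move=> A; rewrite mulr_ge0 ?(rtm_ge0 r)// ltW.
- by move=> A nA; rewrite (rtm_out r)// mulr0.
- by move=> A B oA oB AB; rewrite ler_pM2l// (rtm_le r).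
- by move=> A B AB; rewrite (rtm_add r)// mulrDr.
- move=> U e oU e0; have [K KU Ke] := rtm_inner r oU (divr_gt0 e0 c0).
  by exists K => //; rewrite -(ltr_pM2l c0) mulrDr [c * (e / c)]mulrC divfK ?gt_eqF
    in Ke.
- move=> F e oF e0; have [U FU Ue] := rtm_outer r oF (divr_gt0 e0 c0).
  by exists U => //; rewrite -(ltr_pM2l c0) mulrDr [c * (e / c)]mulrC divfK ?gt_eqF
    in Ue.
Qed.

Lemma rtm_sum k (n : nat) (c : 'I_n -> R) (m_ : 'I_n -> set X -> R) :
  (forall i, 0 <= c i) -> (forall i, rtm k (m_ i)) ->
  rtm k (fun A => \sum_(i < n) c i * m_ i A).
Proof.
move=> c0 rm; elim: n => [|n IH] in c m_ c0 rm *.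
  rewrite (_ : (fun A => _) = fun=> 0); first exact: rtm_cst0.
  by apply/funext => A; rewrite big_ord0.
rewrite (_ : (fun A => _) = (fun A => c ord0 * m_ ord0 A +
    \sum_(i < n) c (lift ord0 i) * m_ (lift ord0 i) A)); last first.
  by apply/funext => A; rewrite big_ord_recl.
by apply: rtmD; [exact: rtmZ|exact: IH].
Qed.

(** Each clause concerns finitely many values, up to a tolerance, hence survives a limit uniform in
    the set. The Markov operator is such a limit of its partial sums. *)
Lemma rtm_uniform_limit k m :
  (forall e, 0 < e -> exists2 m', rtm k m' & forall A, `|m A - m' A| <= e) -> rtm k m.
Proof.
move=> lim; have lim' e : 0 < e -> exists2 m', rtm k m' &
    forall A, m A <= m' A + e /\ m' A <= m A + e.
  move=> e0; have [m' r h] := lim e e0; exists m' => // A.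
  by move: (h A); rewrite ler_norml => /andP[*]; split; lra.
split.
- move=> A; apply/ler_addgt0Pr => e e0; have [m' r h] := lim' e e0.
  by have := h A; have := rtm_ge0 r A; lra.
- move=> A nA; apply/eqP; rewrite -normr_le0; apply/ler_addgt0Pr => e e0.
  by have [m' r /(_ A)] := lim e e0; rewrite (rtm_out r nA) subr0 add0r.
- move=> A B oA oB AB; apply/ler_addgt0Pr => e e0.
  have [m' r h] := lim' (e / 2) ltac:(lra); have := h A; have := h B.
  have := rtm_le r oA oB AB; lra.
- move=> A B AB; apply/eqP; rewrite -subr_eq0 -normr_le0; apply/ler_addgt0Pr => e e0.
  have [m' r h] := lim' (e / 3) ltac:(lra).
  have := rtm_add r AB; have := h A; have := h B; have := h (A `|` B).
  by rewrite add0r ler_norml => *; apply/andP; split; lra.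
- move=> U e oU e0; have [m' r h] := lim' (e / 3) ltac:(lra).
  have [K KU Ke] := rtm_inner r oU (e := e / 3) ltac:(lra); exists K => //.
  by have := h U; have := h K; lra.
- move=> F e oF e0; have [m' r h] := lim' (e / 3) ltac:(lra).
  have [U FU Ue] := rtm_outer r oF (e := e / 3) ltac:(lra); exists U => //.
  by have := h U; have := h F; lra.
Qed.

End real_topological_measures.

(** * Quasi-integrals *)

Section weighted_series.
Context {R : realType}.
Implicit Types (alpha x : nat -> R).

Definition weight_tail alpha (N : nat) : R :=
  fine (\sum_(N <= i <oo) (alpha i)%:E)%E.

Lemma weight_tail_small alpha (e : R) : (forall i, 0 <= alpha i) ->
  (\sum_(0 <= i <oo) (alpha i)%:E <= 1)%E -> 0 < e ->
  \forall N \near \oo, weight_tail alpha N <= e.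
Proof.
move=> a0 a1 e0.
have /fine_cvgP[_ /cvgrPdist_le/(_ e e0)] :=
  @nneseries_tail_cvg R (EFin \o alpha) xpredT (le_lt_trans a1 (ltry 1))
  (fun i _ => a0 i).
by apply: filterS => N; rewrite sub0r normrN; apply: le_trans; exact: ler_norm.
Qed.

Lemma partial_weights_le1 alpha N : (forall i, 0 <= alpha i) ->
  (\sum_(0 <= i <oo) (alpha i)%:E <= 1)%E -> \sum_(i < N) alpha i <= 1.
Proof.
move=> a0 a1; rewrite -lee_fin -sumEFin; apply: le_trans a1.
rewrite -(big_mkord xpredT (fun i => (alpha i)%:E)); apply: nneseries_lim_ge => i _ _.
by rewrite lee_fin.
Qed.

(** The error bound depends on [x] only through [B]. With [x i] the value of the adjoint of [q i] on
    a set, truncation becomes uniform over all sets. *)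
Lemma weighted_series alpha x (B : R) : (forall i, 0 <= alpha i) ->
  (\sum_(0 <= i <oo) (alpha i)%:E <= 1)%E -> 0 <= B -> (forall i, 0 <= x i <= B) ->
  exists2 S : R, (\sum_(0 <= i <oo) (alpha i)%:E * (x i)%:E)%E = S%:E &
    forall N, 0 <= S - \sum_(i < N) alpha i * x i <= B * weight_tail alpha N.
Proof.
move=> a0 a1 B0 xB.
have ax0 i : (0 <= (alpha i)%:E * (x i)%:E)%E.
  by rewrite -EFinM lee_fin mulr_ge0//; case/andP: (xB i).
pose T N : \bar R := (\sum_(N <= i <oo) (alpha i)%:E * (x i)%:E)%E.
pose A N : \bar R := (\sum_(N <= i <oo) (alpha i)%:E)%E.
have A0 N : (0 <= A N)%E by apply: nneseries_ge0 => i _ _; rewrite lee_fin.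
have AN N : (A N <= 1)%E.
  apply: le_trans a1; rewrite (nneseries_split 0 N) ?add0n; last by move=> i _;
    rewrite lee_fin.
  by rewrite leeDr// sume_ge0// => i _; rewrite lee_fin.
have Afin N : A N \is a fin_num.
  by rewrite ge0_fin_numE//; exact: le_lt_trans (AN N) (ltry 1).
have TB N : (0 <= T N <= B%:E * A N)%E.
  apply/andP; split; first exact: nneseries_ge0.
  rewrite -nneseriesZl; last by move=> i _; rewrite lee_fin.
  apply: lee_nneseries => // i _; rewrite -!EFinM lee_fin mulrC ler_wpM2r//.
  by case/andP: (xB i).
have Tfin N : T N \is a fin_num.
  have /andP[T0 TN] := TB N; rewrite ge0_fin_numE//; apply: le_lt_trans TN _.
  by rewrite -(fineK (Afin N)) -EFinM ltry.
exists (fine (T 0%N)); first by rewrite fineK.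
move=> N; have TE : (T 0%N = (\sum_(i < N) alpha i * x i)%:E + T N)%E.
  rewrite {1}/T (nneseries_split 0 N) ?add0n//; congr (_ + _)%E.
  by rewrite big_mkord sumEFin.
rewrite TE fineD//= addrAC subrr add0r -lee_fin fineK// -[X in _ && X]lee_fin fineK//.
rewrite EFinM /weight_tail fineK; [exact: TB|exact: Afin].
Qed.

End weighted_series.

Section quasi_integral.
Context {R : realType} {X : metricType R}.
Implicit Types (m : set X -> R) (f : X -> R) (k : kind).

Local Notation J g a b := (\int[lebesgue_measure]_(t in `[a, b]) g t).
Local Notation itg g a b :=
  ((@lebesgue_measure R).-integrable `[a, b] (EFin \o g)).

Lemma preimage_gt f t : f @^-1` `]t, +oo[ = [set x | t < f x].
Proof. by apply/seteqP; split => x /=; rewrite in_itv/= andbT. Qed.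

Lemma open_superlevel f t : continuous f -> open [set x | t < f x].
Proof.
by move=> cf; apply: (@open_comp _ _ f [set s | t < s]) => // x _; exact: cf.
Qed.

Lemma open_sublevel f t : continuous f -> open [set x | f x < t].
Proof.
by move=> cf; apply: (@open_comp _ _ f [set s | s < t]) => // x _; exact: cf.
Qed.

Lemma closed_superlevel f t : continuous f -> closed [set x | t <= f x].
Proof.
by move=> cf; apply: (@preimage_closed _ _ f [set s | t <= s]) => // x _; exact: cf.
Qed.

Lemma closed_sublevel f t : continuous f -> closed [set x | f x <= t].
Proof.
by move=> cf; apply: (@preimage_closed _ _ f [set s | s <= t]) => // x _; exact: cf.
Qed.

Lemma C0_compact_ge f t : C0 f -> 0 < t -> compact [set x | t <= f x].
Proof.
move=> [cf cK] t0; apply: (subclosed_compact _ (cK t t0));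
  first exact: closed_superlevel.
by move=> x /= /le_trans; apply; exact: ler_norm.
Qed.

Lemma C0_compact_le f t : C0 f -> t < 0 -> compact [set x | f x <= t].
Proof.
move=> [cf cK] t0; have nt0 : 0 < - t by lra.
apply: (subclosed_compact _ (cK (- t) nt0)); first exact: closed_sublevel.
by move=> x /= xt; rewrite -normrN; apply: le_trans (ler_norm _); lra.
Qed.

Lemma sublevelU f t : [set x | f x <= t] `|` [set x | t < f x] = setT.
Proof. by apply/seteqP; split => // x _ /=; case: (leP (f x) t); [left|right]. Qed.

Lemma sublevel_additive_pair f t : C0 f -> t < 0 ->
  additive_pair Plain [set x | f x <= t] [set x | t < f x].
Proof.
move=> C0f t0; split.
  by apply/seteqP; split => // x /= [h1 h2]; move: (lt_le_trans h2 h1); rewrite ltxx.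
rewrite sublevelU; split; [right|left|by left; exact: openT].
- exact: C0_compact_le.
- by case: C0f => cf _; exact: open_superlevel.
Qed.

Definition level m f t : R := m [set x | t < f x].

(* Subtracting the total mass for [t < 0] makes the integral over [[- C, C]]
   independent of [C]. *)
Definition signed_level m f t : R := level m f t - (if t < 0 then m setT else 0).

(** For [t < 0] the sublevel set is compact and its complement open. Additivity on such a pair
    trades a possibly noncompact superlevel set for a compact one. *)
Lemma signed_level_sublevel m f t : rtm Plain m -> C0 f -> t < 0 ->
  signed_level m f t = - m [set x | f x <= t].
Proof.
move=> rm C0f t0; rewrite /signed_level t0 -(sublevelU f t).
rewrite (rtm_add rm (sublevel_additive_pair C0f t0)) /level; ring.
Qed.

Lemma signed_level_ge0 m f t : (forall x, 0 <= f x) -> t < 0 -> signed_level m f t = 0.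
Proof.
move=> f0 t0; rewrite /signed_level t0 /level (_ : [set x | _] = setT) ?subrr//.
by apply/seteqP; split => // x _ /=; exact: lt_le_trans (f0 x).
Qed.

Lemma level_nonincreasing k m f : rtm k m -> continuous f ->
  nonincreasing_fun (level m f).
Proof.
move=> rm cf s t st; apply: (rtm_le rm); try by left; exact: open_superlevel.
by move=> x; exact: le_lt_trans.
Qed.

Lemma level_bounds k m f t : rtm k m -> 0 <= level m f t <= m setT.
Proof. by move=> rm; rewrite (rtm_ge0 rm) (rtm_leT _ rm). Qed.

Lemma step_nonincreasing (c : R) : 0 <= c ->
  nonincreasing_fun (fun t : R => if t < 0 then c else 0).
Proof.
move=> c0 s t st; case: (ltP t 0) => t0; first by rewrite (le_lt_trans st t0).
by case: ifP.
Qed.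

Lemma signed_level_integrable k m f a b : rtm k m -> continuous f ->
  itg (signed_level m f) a b.
Proof.
move=> rm cf; apply: integrable_itvB; apply: nonincreasing_integrable.
  exact: level_nonincreasing rm cf.
by apply: step_nonincreasing; exact: rtm_ge0 rm _.
Qed.

(** Below the infimum of [f] the level is the total mass, and from the supremum on it is 0.
    Enlarging the interval therefore adds exactly what the boundary term removes, and different
    functions can share one interval. *)
Lemma qint_level k m f (C : R) : rtm k m -> continuous f -> 0 <= C ->
  (forall x, `|f x| <= C) ->
  qint (EFin \o m) f = J (level m f) (- C) C - C * m setT.
Proof.
move=> rm cf C0 fC; have ld := level_nonincreasing rm cf.
rewrite /qint /qint_on.
under eq_Rintegral do rewrite preimage_gt.
rewrite /= -/(level m f).
(* On the empty space [inf] and [sup] are the default 0, which need not bound anything, so both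
   sides are computed directly. *)
have [XE|/set0P[x0 _]] := eqVneq [set: X] set0.
  have rE : range f = set0 by rewrite XE image_set0.
  rewrite rE inf0 sup0 XE (rtm_set0 rm) !mulr0 addr0 subr0 integral_itv_point.
  apply/esym; rewrite (_ : level m f = fun=> 0) ?integral_itv_cst ?mulr0//;
    first by lra.
  apply/funext => t; rewrite /level (_ : [set x | _] = set0) ?(rtm_set0 rm)//.
  by apply/seteqP; split => // x; have : [set: X] x by []; rewrite XE.
have ub : ubound (range f) C by move=> _ [x _ <-]; have := fC x;
  rewrite ler_norml => /andP[].
have lb : lbound (range f) (- C) by move=> _ [x _ <-]; have := fC x;
  rewrite ler_norml => /andP[].
have ne : range f !=set0 by exists (f x0), x0.
have infE x : inf (range f) <= f x by apply: ge_inf; [exists (- C)|exists x].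
have supE x : f x <= sup (range f) by apply: ub_le_sup; [exists C|exists x].
have Cinf : - C <= inf (range f) by exact: lb_le_inf.
have supC : sup (range f) <= C by exact: ge_sup.
have infsup := le_trans (infE x0) (supE x0).
set a := inf _ in infE Cinf infsup *; set b := sup _ in supE supC infsup *.
rewrite (@integral_itv_split _ _ (- C) a C) ?(@integral_itv_split _ _ a b C)//;
  do ?[exact: nonincreasing_integrable|exact: le_trans supC].
rewrite (@eq_integral_itvco _ _ (fun=> m setT) (- C) a); last 3 first.
- exact: nonincreasing_integrable.
- exact: cst_integrable_itv.
- move=> t /andP[_ ta]; congr m; apply/seteqP; split => // x _ /=.
  exact: lt_le_trans (infE x).
rewrite (@eq_integral_itvco _ _ (fun=> 0) b C); last 3 first.
- exact: nonincreasing_integrable.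
- exact: cst_integrable_itv.
- move=> t /andP[bt _]; rewrite /level (_ : [set x | _] = set0) ?(rtm_set0 rm)//.
  apply/seteqP; split => // x /=; rewrite ltNge => /negP; apply.
  exact: le_trans (supE x) bt.
rewrite !integral_itv_cst//; ring.
Qed.

Lemma qint_signed_level k m f (C : R) : rtm k m -> continuous f -> 0 <= C ->
  (forall x, `|f x| <= C) ->
  qint (EFin \o m) f = J (signed_level m f) (- C) C.
Proof.
move=> rm cf C0 fC; rewrite (qint_level rm cf C0 fC).
pose step (t : R) := if t < 0 then m setT else 0.
have sd : nonincreasing_fun step by apply: step_nonincreasing; exact: rtm_ge0 rm _.
have stepE : J step (- C) C = C * m setT.
  rewrite (@integral_itv_split _ _ (- C) 0 C)//; last 2 first.
  - by lra.
  - exact: nonincreasing_integrable.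
  rewrite (@eq_integral_itvco _ _ (fun=> m setT) (- C) 0); last 3 first.
  - exact: nonincreasing_integrable.
  - exact: cst_integrable_itv.
  - by move=> t /andP[_ t0]; rewrite /step t0.
  rewrite (@eq_integral_itvco _ _ (fun=> 0) 0 C); last 3 first.
  - exact: nonincreasing_integrable.
  - exact: cst_integrable_itv.
  - by move=> t /andP[t0 _]; rewrite /step ltNge t0.
  by rewrite !integral_itv_cst//; [ring|lra].
rewrite -stepE -RintegralB//; last exact: nonincreasing_integrable.
exact: nonincreasing_integrable (level_nonincreasing rm cf).
Qed.

(** This homogeneity replaces linearity in the function: it is what turns the Lipschitz constant of
    [theta q f] into a factor of the distance. *)
Lemma qint_scale k m f (c : R) : rtm k m -> C0 f -> 0 < c ->
  qint (EFin \o m) (fun x => c * f x) = c * qint (EFin \o m) f.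
Proof.
move=> rm C0f c0; have [C C_gt0 fC] := C0_bounded C0f; have [cf _] := C0f.
have ccf : continuous (fun x => c * f x).
  by move=> x; apply: cvgM; [exact: cvg_cst|exact: cf].
have cfC x : `|c * f x| <= c * C by rewrite normrM gtr0_norm// ler_pM2l.
rewrite (qint_level rm cf (ltW C_gt0) fC) (qint_level rm ccf _ cfC) ?mulr_ge0 ?ltW//.
rewrite mulrBr mulrA; congr (_ - _).
rewrite -nonincreasing_integral_scale//; first last.
- exact: level_nonincreasing rm cf.
- by lra.
rewrite mulrN; apply: eq_Rintegral => t _; congr m.
by apply/seteqP; split => x /=; rewrite ltr_pdivrMr// mulrC.
Qed.

(** The interval has length [2 * C], and a signed level differs by at most [2 * e]: once for the
    superlevel set, once for the total mass. *)
Lemma qint_close k k' m m' f (C e : R) : rtm k m -> rtm k' m' -> continuous f ->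
  0 <= C -> (forall x, `|f x| <= C) ->
  (forall U, open U -> `|m U - m' U| <= e) ->
  `|qint (EFin \o m) f - qint (EFin \o m') f| <= 4 * C * e.
Proof.
move=> rm rm' cf C0 fC mm'.
rewrite (qint_signed_level rm cf C0 fC) (qint_signed_level rm' cf C0 fC).
have -> : 4 * C * e = (C - - C) * (2 * e) by ring.
have e0 : 0 <= e by apply: le_trans (mm' _ openT).
apply: integral_itv_close; [lra|exact: signed_level_integrable rm cf|
  exact: signed_level_integrable rm' cf|].
move=> t _; rewrite /signed_level /level.
have := mm' _ (open_superlevel t cf); have := mm' _ openT.
rewrite !ler_norml => /andP[h1 h2] /andP[h3 h4].
by case: ifP => _; apply/andP; split; lra.
Qed.

Lemma qint_lin k (n : nat) (c : 'I_n -> R) (m_ : 'I_n -> set X -> R) f : C0 f ->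
  (forall i, 0 <= c i) -> (forall i, rtm k (m_ i)) ->
  qint (EFin \o (fun A => \sum_(i < n) c i * m_ i A)) f =
  \sum_(i < n) c i * qint (EFin \o m_ i) f.
Proof.
move=> C0f c0 rm; have [C C_gt0 fC] := C0_bounded C0f; have [cf _] := C0f.
have Cge := ltW C_gt0.
rewrite (qint_level (rtm_sum c0 rm) cf Cge fC).
under [RHS]eq_bigr => i _ do rewrite (qint_level (rm i) cf Cge fC) mulrBr.
rewrite big_split/= sumrN mulr_sumr; congr (_ - _); last first.
  by apply: eq_bigr => i _; ring.
rewrite /level; elim: n => [|n IH] in c m_ c0 rm *.
  rewrite big_ord0; under eq_Rintegral do rewrite big_ord0.
  by rewrite integral_itv_cst ?mulr0//; lra.
rewrite big_ord_recl; under eq_Rintegral do rewrite big_ord_recl.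
have i1 i : itg (level (m_ i) f) (- C) C.
  exact: nonincreasing_integrable (level_nonincreasing (rm i) cf).
rewrite RintegralD//=; last 2 first.
- have rs := rtmZ (c0 ord0) (rm ord0).
  exact: nonincreasing_integrable (level_nonincreasing rs cf).
- have rs := rtm_sum (fun i => c0 (lift ord0 i)) (fun i => rm (lift ord0 i)).
  exact: nonincreasing_integrable (level_nonincreasing rs cf).
rewrite (IH (fun i => c (lift ord0 i)) (fun i => m_ (lift ord0 i)))//.
by rewrite RintegralZl//; exact: i1.
Qed.

End quasi_integral.

(** * Adjoints and the Markov operator *)

Section adjoint_transformations.
Context {R : realType} {X : metricType R}.
Implicit Types (m : set X -> R) (A B C K U V F : set X) (k : kind) (q : set X -> set X).

Lemma image_transformation_Deficient k q :
  image_transformation k q -> image_transformation Deficient q.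
Proof.
move=> [qoc qU qK qadd]; split => // A B [AB [cA cB]]; apply: qadd.
exact: additive_pair_compact.
Qed.

Lemma additive_pair_open_or_compact k A B : additive_pair k A B ->
  [/\ open A \/ compact A, open B \/ compact B & open (A `|` B) \/ compact (A `|` B)].
Proof. by case: k => -[_ []] // cA cB; split; right => //; exact: compactU. Qed.

Section deficient.
Variable q : set X -> set X.
Hypothesis q_image : image_transformation Deficient q.

Lemma image_open U : open U -> open (q U).
Proof. by case: q_image => -[qo _] _ _ _; exact: qo. Qed.

Lemma image_compact K : compact K -> compact (q K).
Proof. by case: q_image => -[_ qc] _ _ _; exact: qc. Qed.

Lemma image_open_or_compact A : open A \/ compact A -> open (q A) \/ compact (q A).
Proof. by move=> [/image_open|/image_compact]; [left|right]. Qed.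

Lemma image_subset_co K U : compact K -> open U -> K `<=` U -> q K `<=` q U.
Proof. by case: q_image => _ qU _ _ cK oU KU; rewrite (qU U oU) => x qx; exists K. Qed.

Lemma image_subset_oo U V : open U -> open V -> U `<=` V -> q U `<=` q V.
Proof.
case: q_image => _ qU _ _ oU oV UV; rewrite (qU U oU) => x [K [cK KU]].
by apply: image_subset_co => //; exact: subset_trans UV.
Qed.

Lemma image_subset_cc K C : compact K -> compact C -> K `<=` C -> q K `<=` q C.
Proof.
case: q_image => _ _ qK _ cK cC KC; rewrite (qK C cC) => x qx U [oU CU].
by apply: image_subset_co qx => //; exact: subset_trans CU.
Qed.

Lemma image_subset_oc U C : open U -> compact C -> U `<=` C -> q U `<=` q C.
Proof.
case: q_image => _ qU _ _ oU cC UC; rewrite (qU U oU) => x [K [cK KU]].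
by apply: image_subset_cc => //; exact: subset_trans UC.
Qed.

Lemma image_set0 : q set0 = set0.
Proof.
case: q_image => _ _ _ qadd.
have [|+ _] := qadd set0 set0; last by rewrite setIid.
by apply: additive_pair_compact; rewrite ?setI0//; exact: compact0.
Qed.

Hypothesis X_loc_compact : locally_compact [set: X].

(** The union defining [q U] runs over compact sets, whose images are not open. Thickening each of
    them to an open set with a compact envelope inside [U] gives a directed open cover of [C]. *)
Lemma image_inner U C : open U -> compact C -> C `<=` q U ->
  exists2 K, compact K /\ K `<=` U & C `<=` q K.
Proof.
move=> oU cC CU; pose D := [set V | open V /\ exists2 K, compact K /\ K `<=` U & V
  `<=` K].
have [||V V' [oV [K [cK KU] VK]] [oV' [K' [cK' KU'] VK']]|x /CU|V [oV [K [cK KU] VK]]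
  CV] :=
  @compact_directed_cover X _ D q C cC.
- exists set0; split; first exact: open0.
  by exists set0; [split; [exact: compact0|exact: sub0set]|exact: sub0set].
- by move=> V [oV _]; exact: image_open.
- have oVV := openU oV oV'; exists (V `|` V').
    split=> //; exists (K `|` K'); last exact: setUSS.
    by split; [exact: compactU|rewrite subUset].
  by rewrite subUset; split; apply: image_subset_oo.
- case: q_image => _ qU _ _; rewrite (qU U oU) => -[K [cK KU] qx].
  have [L [cL LU] KL] := compact_nbhd X_loc_compact cK oU KU.
  exists L°; last exact: (image_subset_co cK (@open_interior _ L) KL qx).
  by split; [exact: open_interior|exists L => //; exact: interior_subset].
- by exists K => //; apply: subset_trans CV _; exact: image_subset_oc.
Qed.

(** Dual to the inner case: if [C] runs through the compact neighbourhoods of [K], the complements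
    of [q C] form a directed open cover of the compact part of [q C0] outside [V]. *)
Lemma image_outer K V : compact K -> open V -> q K `<=` V ->
  exists2 U, open U /\ K `<=` U & q U `<=` V.
Proof.
move=> cK oV KV; pose D := [set C | compact C /\ K `<=` C°].
have [C0 [cC0 _] KC0] := compact_nbhd X_loc_compact cK openT (@subsetT _ K).
have DI C C' : D C -> D C' -> D (C `&` C').
  move=> [cC KC] [cC' KC']; split; last by rewrite interiorI subsetI.
  by apply: compact_closedI => //; exact: metric_compact_closed.
have cD : compact (q C0 `\` V).
  by apply: compact_closedI; [exact: image_compact|exact: open_closedC].
have [||C C' DC DC'|x [_ nVx]|C DC CV] :=
  @compact_directed_cover X _ D (fun C => ~` q C) _ cD.
- by exists C0.
- by move=> C [cC _]; exact: (closed_openC (metric_compact_closed (image_compact cC))).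
- have [cCC _] := DI _ _ DC DC'; exists (C `&` C'); first exact: DI.
  rewrite -setCI; apply: subsetC => x qx; split; apply: image_subset_cc qx => //.
  + exact: DC.1.
  + exact: DC'.1.
- apply: contrapT => nx; apply: nVx; apply: KV; case: q_image => _ _ qK _.
  rewrite (qK K cK) => U [oU KU]; apply: contrapT => nqx; apply: nx.
  have [C [cC CU] KC] := compact_nbhd X_loc_compact cK oU KU.
  by exists C => //= qx; apply: nqx; exact: image_subset_co qx.
(* The cover controls only points of [q C0], so [C] is cut down to lie in [C0]. *)
- have [cCC KCC] := DI _ _ DC (conj cC0 KC0).
  have oI := @open_interior X (C `&` C0).
  exists (C `&` C0)°; first by [].
  move=> x /(image_subset_oc oI cCC (@interior_subset _ _)) qx.
  have qC : q C x by apply: image_subset_cc qx => //; exact: DC.1.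
  have qC0 : q C0 x by apply: image_subset_cc qx.
  by apply: contrapT => nVx; apply: (CV x).
Qed.

End deficient.

Lemma image_additive_pair k q A B : image_transformation k q ->
  additive_pair k A B -> additive_pair k (q A) (q B).
Proof.
move=> qI AB; have qD := image_transformation_Deficient qI.
have [oA oB oAB] := additive_pair_open_or_compact AB.
have [_ _ _ /(_ A B AB)[qAB qE]] := qI.
split=> //; case: k AB qI => [_ _|[_ [cA cB]] _].
  by rewrite -qE; split; exact: image_open_or_compact.
by split; exact: image_compact.
Qed.

Definition radjoint q m A : R := fine (adjoint q (EFin \o m) A).

Section real_adjoint.
Hypothesis X_loc_compact : locally_compact [set: X].
Variables (k : kind) (q : set X -> set X) (m : set X -> R).
Hypotheses (q_image : image_transformation k q) (rm : rtm k m).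

Lemma radjoint_open_or_compact A : open A \/ compact A -> radjoint q m A = m (q A).
Proof. by move=> oA; rewrite /radjoint /adjoint asboolT. Qed.

Lemma adjointE : adjoint q (EFin \o m) = EFin \o radjoint q m.
Proof.
apply/funext => A; rewrite /radjoint /=.
have [oA|nA] := pselect (open A \/ compact A); first by rewrite /adjoint asboolT.
rewrite /adjoint (asboolF nA); case: asboolP => // cA; rewrite fineK//.
rewrite ge0_fin_numE; last by apply/ereal_infP => _ [U _ <-];
  rewrite lee_fin (rtm_ge0 rm).
apply: le_lt_trans (ltry (m (q setT))); apply: ereal_inf_lbound; exists setT => //.
by split; [exact: openT|exact: subsetT].
Qed.

(** Regularity of [m] provides a compact subset of [q U] or an open neighbourhood of [q F], and
    [image_inner] or [image_outer] pulls it back through [q]. On closed sets neither open nor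
    compact, outer regularity is the defining infimum. *)
Lemma radjoint_rtm : rtm k (radjoint q m).
Proof.
have qD := image_transformation_Deficient q_image.
have oo U V : open U -> open V -> U `<=` V -> m (q U) <= m (q V).
  move=> oU oV UV; apply: (rtm_le rm); [left|left|]; try exact: (image_open qD).
  exact: (image_subset_oo qD).
have co F U : closed F -> open U -> F `<=` U -> radjoint q m F <= m (q U).
  move=> cF oU FU; have [oF|nF] := pselect (open F \/ compact F).
    rewrite radjoint_open_or_compact//; apply: (rtm_le rm).
    - exact: open_or_compact_closed (image_open_or_compact qD oF).
    - by left; exact: (image_open qD).
    - by case: oF => oF; [exact: (image_subset_oo qD)|exact: (image_subset_co qD)].
  rewrite -lee_fin -[X in (X <= _)%E]/((EFin \o radjoint q m) F) -adjointE.
  by rewrite /adjoint (asboolF nF) asboolT//; apply: ereal_inf_lbound; exists U.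
apply: rtm_open_intro.
- move=> A; rewrite /radjoint fine_ge0// /adjoint; case: ifP => _;
    first by rewrite lee_fin (rtm_ge0 rm).
  by case: ifP => // _; apply/ereal_infP => _ [U _ <-]; rewrite lee_fin (rtm_ge0 rm).
- move=> A nA; rewrite /radjoint /adjoint asboolF.
    by rewrite asboolF// => cA; apply: nA; right.
  by move=> /open_or_compact_closed.
- by move=> U V oU oV UV; rewrite !radjoint_open_or_compact; [exact: oo|left|left].
- by move=> F U cF oU FU; rewrite (radjoint_open_or_compact (or_introl oU)); exact: co.
- move=> A B AB; have [oA oB oAB] := additive_pair_open_or_compact AB.
  rewrite !radjoint_open_or_compact//.
  have [_ _ _ /(_ A B AB)[_ ->]] := q_image.
  by apply: (rtm_add rm); exact: image_additive_pair.
- move=> U e oU e0.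
  have [C [cC CU] Ce] := rtm_inner rm (image_open qD oU) e0.
  have [K KU CK] := image_inner qD X_loc_compact oU cC CU.
  have cK := KU.1; exists K => //; rewrite !radjoint_open_or_compact;
    [|by right|by left].
  apply: (lt_le_trans Ce); rewrite lerD2r; apply: (rtm_le rm) => //;
    right; apply: metric_compact_closed => //; exact: (image_compact qD).
- move=> F e cF e0; have [oF|nF] := pselect (open F \/ compact F).
    rewrite (radjoint_open_or_compact oF); case: oF => [oF|cF'].
      exists F; first by split.
      by rewrite radjoint_open_or_compact; [rewrite ltrDl|left].
    have [V [oV FV] Ve] := rtm_outer rm (metric_compact_closed (image_compact qD
      cF')) e0.
    have [U [oU FU] UV] := image_outer qD X_loc_compact cF' oV FV.
    exists U => //; rewrite radjoint_open_or_compact; last by left.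
    apply: le_lt_trans Ve; apply: (rtm_le rm) => //; left => //; exact: (image_open qD).
  have : (adjoint q (EFin \o m) F < (radjoint q m F + e)%:E)%E.
    by rewrite adjointE lte_fin ltrDl.
  rewrite {1}/adjoint (asboolF nF) asboolT// => /ereal_inf_lt[_ [U [oU FU] <-]] Ue.
  by exists U => //; rewrite radjoint_open_or_compact; last by left.
Qed.

Lemma radjoint_setT : radjoint q m setT <= m setT.
Proof. by rewrite radjoint_open_or_compact ?(rtm_leT _ rm)//; left; exact: openT. Qed.

End real_adjoint.

Section markov.
Hypothesis X_loc_compact : locally_compact [set: X].
Variables (k : kind) (q : nat -> set X -> set X) (alpha : nat -> R).
Hypothesis q_alpha : transformation_system k q alpha.

Definition rmarkov m A : R := fine (markov_operator q alpha (EFin \o m) A).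

Definition markov_sum m (N : nat) A : R := \sum_(i < N) alpha i * radjoint (q i) m A.

Lemma markov_sum_rtm m N : rtm k m -> rtm k (markov_sum m N).
Proof.
case: q_alpha => qI a0 _ rm.
apply: (@rtm_sum _ _ k N (fun i => alpha i) (fun i => radjoint (q i) m)) => i.
  exact: a0.
exact (radjoint_rtm X_loc_compact (qI i) rm).
Qed.

Lemma markov_operatorE m A : rtm k m ->
  markov_operator q alpha (EFin \o m) A = (rmarkov m A)%:E /\
  forall N, 0 <= rmarkov m A - markov_sum m N A <= m setT * weight_tail alpha N.
Proof.
case: q_alpha => qI a0 a1 rm.
have rB i : 0 <= radjoint (q i) m A <= m setT.
  have r := radjoint_rtm X_loc_compact (qI i) rm.
  by rewrite (rtm_ge0 r)/=; exact: le_trans (rtm_leT _ r) (radjoint_setT (q i) rm).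
have [S SE SN] := weighted_series a0 a1 (rtm_ge0 rm setT) rB.
have E : markov_operator q alpha (EFin \o m) A = S%:E.
  by rewrite /markov_operator -SE; apply: eq_eseriesr => i _;
    rewrite (adjointE (q i) rm).
by rewrite /rmarkov E.
Qed.

Lemma markov_operator_EFin m : rtm k m ->
  markov_operator q alpha (EFin \o m) = EFin \o rmarkov m.
Proof. by move=> rm; apply/funext => A; have [] := markov_operatorE A rm. Qed.

Lemma markov_sum_close m (e : R) : rtm k m -> 0 < e ->
  \forall N \near \oo, forall A, `|rmarkov m A - markov_sum m N A| <= e.
Proof.
move=> rm e0; have [_ a0 a1] := q_alpha; have m0 := rtm_ge0 rm setT.
have m1 : 0 < m setT + 1 by lra.
apply: filterS (weight_tail_small a0 a1 (divr_gt0 e0 m1)) => N NE A.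
have [_ /(_ N)/andP[h1 h2]] := markov_operatorE A rm.
rewrite ger0_norm//; apply: (le_trans h2); move: NE; rewrite ler_pdivlMr// mulrC.
have w0 : 0 <= weight_tail alpha N.
  by rewrite /weight_tail fine_ge0// nneseries_ge0// => i _ _; rewrite lee_fin.
by move=> h; apply: le_trans h; rewrite ler_wpM2r// lerDl.
Qed.

Lemma rmarkov_rtm m : rtm k m -> rtm k (rmarkov m).
Proof.
move=> rm; apply: rtm_uniform_limit => e e0; have [N h] :=
  filter_ex (markov_sum_close rm e0).
by exists (markov_sum m N); first exact: markov_sum_rtm.
Qed.

Lemma rmarkov_setT m : rtm k m -> rmarkov m setT <= m setT.
Proof.
(* With no terms kept, the truncation error is the whole value. *)
move=> rm; have [_ /(_ 0%N)] := markov_operatorE setT rm.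
rewrite /markov_sum big_ord0 subr0 => /andP[_ /le_trans]; apply.
have [_ a0 a1] := q_alpha; rewrite -[leRHS]mulr1; apply: ler_wpM2l;
  first exact: rtm_ge0 rm _.
rewrite -lee_fin /weight_tail fineK// ge0_fin_numE; last first.
  by apply: nneseries_ge0 => i _ _; rewrite lee_fin.
exact: le_lt_trans a1 (ltry 1).
Qed.

End markov.
End adjoint_transformations.

(** * Quasi-homomorphisms and the contraction estimate *)

Section quasi_homomorphism.
Context {R : realType} {X : metricType R}.
Implicit Types (m : set X -> R) (A B C K U V F : set X) (k : kind)
  (q : set X -> set X) (f : X -> R) (x y : X).

Local Notation J g a b := (\int[lebesgue_measure]_(t in `[a, b]) g t).

Definition rpoint_mass y A : R := if `[< open A \/ closed A >] then \1_A y else 0.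

Lemma point_massE y : point_mass y = EFin \o rpoint_mass y.
Proof. by apply/funext => A; rewrite /point_mass /rpoint_mass /=; case: ifP. Qed.

Lemma rpoint_mass1 y A : open A \/ closed A -> A y -> rpoint_mass y A = 1.
Proof. by move=> oA Ay; rewrite /rpoint_mass asboolT// indicE mem_set. Qed.

Lemma rpoint_mass0 y A : ~ A y -> rpoint_mass y A = 0.
Proof.
by move=> nAy; rewrite /rpoint_mass; case: ifP => // _; rewrite indicE memNset.
Qed.

Lemma rpoint_mass_ge0 y A : 0 <= rpoint_mass y A.
Proof. by rewrite /rpoint_mass; case: ifP => // _; rewrite indicE. Qed.

Lemma rpoint_mass_rtm k y : rtm k (rpoint_mass y).
Proof.
split.
- exact: rpoint_mass_ge0.
- by move=> A nA; rewrite /rpoint_mass asboolF.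
- move=> A B oA oB AB; have [Ay|nAy] := pselect (A y).
    by rewrite !rpoint_mass1//; exact: AB.
  by rewrite (rpoint_mass0 nAy) rpoint_mass_ge0.
- move=> A B AB; have [oA oB oAB] := additive_pair_open_or_closed AB.
  case: AB => AB _.
  have [Ay|nAy] := pselect (A y).
    have nBy : ~ B y by move=> By; have : (A `&` B) y by []; rewrite AB.
    by rewrite (rpoint_mass0 nBy) addr0 !rpoint_mass1//; left.
  rewrite (rpoint_mass0 nAy) add0r; have [By|nBy] := pselect (B y).
    by rewrite !rpoint_mass1//; right.
  by rewrite !rpoint_mass0// => -[].
- move=> U e oU e0; have [Uy|nUy] := pselect (U y).
    exists [set y]; first by split; [exact: compact_set1|move=> _ ->].
    rewrite !rpoint_mass1 ?ltrDl//; last by left.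
    by right; apply: metric_compact_closed; exact: compact_set1.
  exists set0; first by split; [exact: compact0|exact: sub0set].
  by rewrite !rpoint_mass0 ?add0r.
- move=> F e cF e0; have [Fy|nFy] := pselect (F y).
    exists setT; first by split; [exact: openT|exact: subsetT].
    by rewrite !rpoint_mass1 ?ltrDl//; [right|left; exact: openT].
  exists (~` [set y]).
    split; last by move=> x Fx xy; apply: nFy; rewrite -xy.
    by apply: closed_openC; apply: metric_compact_closed; exact: compact_set1.
  by rewrite !rpoint_mass0 ?add0r// => /(_ erefl).
Qed.

Hypothesis X_loc_compact : locally_compact [set: X].
Variables (k : kind) (q : set X -> set X).
Hypothesis q_image : image_transformation k q.

(** A compact subset of an open superlevel set lies in a slightly higher one, and [q] of an open set
    is the union over its compact subsets. This right continuity gives the strict inequality in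
    [lt_theta]. *)
Lemma image_superlevel_right f t y : continuous f -> q [set x | t < f x] y ->
  exists2 s, t < s & q [set x | s < f x] y.
Proof.
move=> cf; have qD := image_transformation_Deficient q_image.
have oft s := @open_superlevel _ _ f s cf.
have [_ /(_ _ (oft t)) qU _ _] := qD; rewrite {1}qU => -[K [cK Kt] qKy].
have [|||x Kx|s ts Ks] := @compact_directed_cover X _ [set s | t < s]
  (fun s => [set x | s < f x]) K cK.
- by exists (t + 1); rewrite /= ltrDl.
- by move=> s _.
- move=> s s' ts ts'; exists (Num.min s s'); first by rewrite /= lt_min ts.
  by move=> x /= [|]; rewrite gt_min => ->//; rewrite orbT.
- have /= tx := Kt x Kx; exists ((t + f x) / 2); rewrite /=; lra.
- by exists s => //; exact: (image_subset_co qD cK (oft s) Ks).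
Qed.

Section theta.
Variable f : X -> R.
Hypothesis C0f : C0 f.

Let cf : continuous f. Proof. by case: C0f. Qed.

Let radj y := radjoint q (rpoint_mass y).

Let radj_rtm y : rtm k (radj y).
Proof. exact (radjoint_rtm X_loc_compact q_image (rpoint_mass_rtm k y)). Qed.

Let radj1 y U : open U -> q U y -> radj y U = 1.
Proof.
move=> oU qUy; rewrite /radj radjoint_open_or_compact; last by left.
rewrite rpoint_mass1//; left; apply: image_open oU.
exact: image_transformation_Deficient q_image.
Qed.

Let radj0 y U : open U -> ~ q U y -> radj y U = 0.
Proof.
by move=> oU qUy; rewrite /radj radjoint_open_or_compact ?rpoint_mass0//; left.
Qed.

Let thetaE (C : R) y : 0 <= C -> (forall x, `|f x| <= C) ->
  theta q f y = J (level (radj y) f) (- C) C - C * radj y setT.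
Proof.
move=> C_ge0 fC; rewrite /theta point_massE (adjointE q (rpoint_mass_rtm k y)).
exact: qint_level (radj_rtm y) cf C_ge0 fC.
Qed.

Lemma theta_notin y : ~ q setT y -> theta q f y = 0.
Proof.
move=> nqy; have [C C_gt0 fC] := C0_bounded C0f.
have qD := image_transformation_Deficient q_image.
rewrite (thetaE y (ltW C_gt0) fC) (radj0 openT nqy) mulr0 subr0.
rewrite (_ : level _ _ = fun=> 0) ?integral_itv_cst ?mulr0//; first by lra.
apply/funext => t; apply: radj0; first exact: open_superlevel.
move=> qt; apply: nqy; apply: (image_subset_oo qD) qt => //;
  first exact: open_superlevel.
exact: openT.
Qed.

(** For [y] in [q setT] the adjoint of the point mass has total mass 1 and takes only the values 0
    and 1 on open sets. Its level function is a step from 1 down to 0, and [theta q f y] is the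
    place of the jump. *)
Lemma lt_theta t y : q setT y -> (t < theta q f y) <-> q [set x | t < f x] y.
Proof.
move=> qy; have [C0' C0'_gt0 fC0'] := C0_bounded C0f.
have qD := image_transformation_Deficient q_image.
pose C := Num.max C0' (`|t| + 1).
have fC x : `|f x| <= C by rewrite le_max fC0'.
have C_gt0 : 0 < C by rewrite lt_max C0'_gt0.
have : `|t| < C by rewrite lt_max; apply/orP; right; rewrite ltrDl.
rewrite ltr_norml => /andP[Ct tC].
have oft s : open [set x | s < f x] by exact: open_superlevel.
have ld : nonincreasing_fun (level (radj y) f) := level_nonincreasing (radj_rtm y) cf.
have li a b := nonincreasing_integrable a b ld.
have l0 s : 0 <= level (radj y) f s by exact: rtm_ge0 (radj_rtm y) _.
have l1 s : level (radj y) f s <= 1.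
  by rewrite /level -(radj1 openT qy); exact: rtm_leT (radj_rtm y).
rewrite (thetaE y (ltW C_gt0) fC) (radj1 openT qy) mulr1; split.
  move=> tth; apply: contrapT => nqt; move: tth; apply/negP; rewrite -leNgt.
  have lt0 s : t <= s <= C -> 0 <= level (radj y) f s <= 0.
    move=> /andP[ts _]; rewrite l0/=; apply: (le_trans (ld _ _ ts)).
    by rewrite /level radj0.
  rewrite (@integral_itv_split _ _ (- C) t C)//; [|exact: ltW|exact: ltW].
  have /andP[_ h1] := integral_itv_bounds (ltW tC) (li _ _) lt0.
  have l01 s : - C <= s <= t -> 0 <= level (radj y) f s <= 1 by rewrite l0 l1.
  have /andP[_ h2] := integral_itv_bounds (ltW Ct) (li _ _) l01.
  by move: h1 h2; lra.
move=> /(image_superlevel_right cf)[s ts qs].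
have sC : s <= C.
  rewrite leNgt; apply/negP => Cs.
  have E : [set x | s < f x] = set0.
    apply/seteqP; split => x //= sx; have := fC x; rewrite leNgt => /negP; apply.
    exact: lt_le_trans (lt_trans Cs sx) (ler_norm _).
  by move: qs; rewrite E (image_set0 qD).
have Cs : - C <= s by apply: ltW; exact: lt_trans ts.
have ls r : - C <= r <= s -> 1 <= level (radj y) f r <= 1.
  move=> /andP[_ rs]; rewrite l1 andbT; apply: le_trans (ld _ _ rs).
  by rewrite /level radj1.
rewrite (@integral_itv_split _ _ (- C) s C)//.
have /andP[h1 _] := integral_itv_bounds Cs (li _ _) ls.
have l01 r : s <= r <= C -> 0 <= level (radj y) f r <= 1 by rewrite l0 l1.
have /andP[h2 _] := integral_itv_bounds sC (li _ _) l01.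
by move: h1 h2; lra.
Qed.

(** Off [q setT] the function [theta q f] is 0; such points stay out of the left side exactly
    because [t] is nonnegative. *)
Lemma theta_superlevel t : 0 <= t ->
  [set y | t < theta q f y] = q [set x | t < f x].
Proof.
move=> t0; have qD := image_transformation_Deficient q_image.
have qT y : q [set x | t < f x] y -> q setT y.
  by apply: (image_subset_oo qD) => //; [exact: open_superlevel|exact: openT].
apply/seteqP; split => y /=.
  have [qy /(lt_theta _ qy)//|nqy] := pselect (q setT y).
  by rewrite theta_notin// ltNge t0.
by move=> qt; apply/(lt_theta _ (qT _ qt)).
Qed.

(** For [t < 0] the left side lies in [q setT], which splits into the images of the sublevel and
    superlevel sets; [lt_theta] decides between the two. *)
Lemma theta_sublevel t : k = Plain -> t < 0 ->
  [set y | theta q f y <= t] = q [set x | f x <= t].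
Proof.
move=> kE t0; have AP : additive_pair k [set x | f x <= t] [set x | t < f x].
  by rewrite kE; exact: sublevel_additive_pair.
have [_ _ _ /(_ _ _ AP)[qI]] := q_image; rewrite sublevelU => qT.
apply/seteqP; split => y /=.
  move=> tht; have qy : q setT y.
    by apply: contrapT => nqy; move: tht; rewrite theta_notin// leNgt t0.
  move: (qy); rewrite qT => -[//|/(lt_theta t qy)]; by rewrite ltNge tht.
move=> qt; have qy : q setT y by rewrite qT; left.
rewrite leNgt; apply/negP => /(lt_theta t qy) qt'.
by have : (q [set x | f x <= t] `&` q [set x | t < f x]) y by []; rewrite qI.
Qed.

End theta.

End quasi_homomorphism.

(** * Change of variables and the contraction estimate *)

Section adjoint_integral.
Context {R : realType} {X : metricType R}.
Implicit Types (m : set X -> R) (f : X -> R) (k : kind).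
Hypothesis X_loc_compact : locally_compact [set: X].

Lemma qint_adjoint k q m f : image_transformation k q -> rtm k m ->
  C0 f -> C0 (theta q f) ->
  (k = Deficient -> forall x, 0 <= f x /\ 0 <= theta q f x) ->
  qint (EFin \o radjoint q m) f = qint (EFin \o m) (theta q f).
Proof.
move=> qI rm C0f C0th f0.
have [C1 C1_gt0 fC1] := C0_bounded C0f; have [C2 C2_gt0 fC2] := C0_bounded C0th.
pose C := Num.max C1 C2.
have fC x : `|f x| <= C by rewrite le_max fC1.
have thC x : `|theta q f x| <= C by rewrite le_max fC2 orbT.
have C_ge0 : 0 <= C by rewrite le_max ltW.
have rr := radjoint_rtm X_loc_compact qI rm.
have [cf _] := C0f; have [cth _] := C0th.
rewrite (qint_signed_level rr cf C_ge0 fC) (qint_signed_level rm cth C_ge0 thC).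
apply: eq_Rintegral => t _; have [t0|t0] := ltP t 0; last first.
  rewrite /signed_level ltNge t0 !subr0 /level radjoint_open_or_compact; last first.
    by left; exact: open_superlevel.
  by rewrite -(theta_superlevel X_loc_compact qI C0f t0).
case: k qI rm f0 rr => qI rm f0 rr; last first.
  by rewrite !signed_level_ge0// => x; have [] := f0 erefl x.
rewrite (signed_level_sublevel rr C0f t0) (signed_level_sublevel rm C0th t0).
rewrite radjoint_open_or_compact; last by right; exact: C0_compact_le.
by rewrite (theta_sublevel X_loc_compact qI C0f erefl t0).
Qed.

Lemma Lip_c_C0 k s f : Lip_c k s f -> C0 f.
Proof. by move=> [_ /Cc_C0]. Qed.

Lemma Lip_c_scale k s f : 0 < s -> Lip_c k s f -> Lip_c k 1 (fun x => s^-1 * f x).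
Proof.
move=> s0 [[cf fs] [_ fc] f0].
have si : 0 < s^-1 by rewrite invr_gt0.
have csf : continuous (fun x => s^-1 * f x).
  by move=> x; apply: cvgM; [exact: cvg_cst|exact: cf].
split; last by move=> kD x; rewrite mulr_ge0 ?f0 ?ltW.
- split=> // x y; rewrite -mulrBr normrM gtr0_norm// mul1r.
  by rewrite mulrC ler_pdivrMr// mulrC.
- split=> //; rewrite (_ : [set x | _] = [set x | f x != 0])//.
  by apply/seteqP; split => x /=; rewrite mulf_eq0 negb_or ?(gt_eqF si)//= => /andP[].
Qed.

(** Each term of the truncated series contributes at most [alpha i * si * D], by rescaling
    [theta (q i) f] to Lipschitz constant 1, and the weights sum to at most 1. The real [D] keeps
    the estimate free of infinite distances. *)
Lemma rmarkov_contracting k (q : nat -> set X -> set X) (alpha : nat -> R) (s D : R)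
  m m' :
  transformation_system k q alpha -> system_contractivity_factor k q s ->
  rtm k m -> rtm k m' -> 0 <= D ->
  (forall f, Lip_c k 1 f -> `|qint (EFin \o m) f - qint (EFin \o m') f| <= D) ->
  forall f, Lip_c k 1 f ->
  `|qint (EFin \o rmarkov q alpha m) f - qint (EFin \o rmarkov q alpha m') f| <= s * D.
Proof.
move=> qa qs rm rm' D0 mD f Lf; have [qI a0 a1] := qa.
have C0f := Lip_c_C0 Lf; have [C C_gt0 fC] := C0_bounded C0f.
have cf : continuous f by case: C0f.
have s_ge0 : 0 <= s by have [si [/andP[/ltW]]] := qs 0%N; move=> + _ _ => /le_trans;
  apply.
(* By [qint_close] each of the two truncations costs [4 * C * d], which is [e / 2]. *)
apply/ler_addgt0Pr => e e0; pose d := e / (8 * C).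
have d0 : 0 < d by rewrite divr_gt0// mulr_gt0.
have [N [h h']] := filter_ex (filterI (markov_sum_close X_loc_compact qa rm d0)
  (markov_sum_close X_loc_compact qa rm' d0)).
have close n (rn : rtm k n) (hn : forall A, `|rmarkov q alpha n A - markov_sum q
  alpha n N A| <= d) :
    `|qint (EFin \o rmarkov q alpha n) f - qint (EFin \o markov_sum q alpha n N) f|
      <= e / 2.
  have -> : e / 2 = 4 * C * d by rewrite /d; field; rewrite gt_eqF.
  apply: (qint_close (rmarkov_rtm X_loc_compact qa rn) (markov_sum_rtm X_loc_compact
    qa N rn) cf _ fC).
    exact: ltW.
  by move=> U _; exact: hn.
have {h} := close m rm h; have {h'} := close m' rm' h'.
have sumE n : rtm k n -> qint (EFin \o markov_sum q alpha n N) f =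
    \sum_(i < N) alpha i * qint (EFin \o n) (theta (q i) f).
  move=> rn; rewrite (@qint_lin _ _ k N (fun i => alpha i) (fun i =>
    radjoint (q i) n) f)//; last first.
    by move=> i; exact (radjoint_rtm X_loc_compact (qI i) rn).
  apply: eq_bigr => i _; have [si [_ qsi] _] := qs i.
  have Lth : Lip_c k si (theta (q i) f) by apply: qsi; exists f.
  rewrite (qint_adjoint (qI i) rn C0f (Lip_c_C0 Lth))// => kD x.
  by case: Lf Lth => _ _ /(_ kD x) ? [_ _ /(_ kD x)].
rewrite (sumE _ rm) (sumE _ rm') => h' h.
suff H : `|\sum_(i < N) alpha i * qint (EFin \o m) (theta (q i) f) -
    \sum_(i < N) alpha i * qint (EFin \o m') (theta (q i) f)| <= s * D.
  by move: h h' H; rewrite !ler_norml => /andP[? ?] /andP[? ?] /andP[? ?];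
    apply/andP; split; lra.
rewrite -sumrB; apply: (le_trans (ler_norm_sum _ _ _)).
have a1' := partial_weights_le1 N a0 a1.
apply: (@le_trans _ _ (\sum_(i < N) alpha i * (s * D))); last first.
  by rewrite -mulr_suml -[leRHS]mul1r ler_wpM2r// mulr_ge0.
apply: ler_sum => i _; rewrite -mulrBr normrM ger0_norm//; apply: ler_wpM2l => //.
have [si [/andP[si0 _] qsi] sis] := qs i.
have Lth : Lip_c k si (theta (q i) f) by apply: qsi; exists f.
have scaleE n : rtm k n -> qint (EFin \o n) (theta (q i) f) =
    si * qint (EFin \o n) (fun x => si^-1 * theta (q i) f x).
  move=> rn; rewrite -(qint_scale rn (Lip_c_C0 (Lip_c_scale si0 Lth)) si0); congr qint.
  by apply/funext => x; rewrite mulrA divff ?mul1r// gt_eqF.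
rewrite (scaleE _ rm) (scaleE _ rm') -mulrBr normrM gtr0_norm//.
apply: ler_pM => //; first exact: ltW.
by apply: mD; exact: Lip_c_scale.
Qed.

End adjoint_integral.

(** * Vague convergence *)

Section vague_convergence.
Context {R : realType} {X : metricType R}.
Implicit Types (m : set X -> R) (ms : nat -> set X -> R) (A B K U F : set X)
  (f : X -> R) (k : kind).

Local Notation J g a b := (\int[lebesgue_measure]_(t in `[a, b]) g t).

(** A portmanteau-type condition. In the lower half one compact [K] serves all large [n], so mass
    cannot drift to the boundary of [U]; the upper half tests compact sets only, so mass may be lost
    at infinity. *)
Definition vague_cvg ms m := forall U, open U -> forall e : R, 0 < e ->
  (exists2 K, compact K /\ K `<=` U & \forall n \near \oo, m U <= ms n K + e) /\
  (forall K, compact K -> K `<=` U -> \forall n \near \oo, ms n K <= m U + e).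

Lemma vague_cvg_level ms m f s t (e : R) : (forall n, rtm Deficient (ms n)) ->
  rtm Deficient m -> vague_cvg ms m -> C0 f -> 0 < s -> s < t -> 0 < e ->
  \forall n \near \oo, level (ms n) f t <= level m f s + e /\
    level m f t <= level (ms n) f s + e.
Proof.
move=> rm_ rm mm C0f s0 st e0; have [cf _] := C0f.
have ost r : open [set x | r < f x] by exact: open_superlevel.
have [_ /(_ _ (C0_compact_ge C0f (lt_trans s0 st)) _)] := mm _ (ost s) e e0.
have h0 : [set x | t <= f x] `<=` [set x | s < f x] by move=> x /=; exact: lt_le_trans.
move=> /(_ h0) h1; have [[K [cK Kt] h2] _] := mm _ (ost t) e e0.
apply: filterS (filterI h1 h2) => n [{}h1 {}h2]; split.
  apply: le_trans h1; apply: (rtm_le (rm_ n)); [by left| |by move=> x /ltW].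
  by right; exact: closed_superlevel.
apply: (le_trans h2); rewrite lerD2r; apply: (rtm_le (rm_ n)).
- by right; exact: metric_compact_closed.
- by left.
- by move=> x /Kt /=; exact: lt_trans.
Qed.

Lemma vague_cvg_sublevel ms m f s t (e : R) : (forall n, rtm Plain (ms n)) ->
  rtm Plain m -> vague_cvg ms m -> C0 f -> s < t -> t < 0 -> 0 < e ->
  \forall n \near \oo, signed_level (ms n) f t <= signed_level m f s + e /\
    signed_level m f t <= signed_level (ms n) f s + e.
Proof.
move=> rm_ rm mm C0f st t0 e0; have [cf _] := C0f.
have s0 := lt_trans st t0.
have ot : open [set x | f x < t] by exact: open_sublevel.
have cs r : closed [set x | f x <= r] by exact: closed_sublevel.
have [[K [cK Kt] h2] /(_ _ (C0_compact_le C0f s0) _)] := mm _ ot e e0.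
have h0 : [set x | f x <= s] `<=` [set x | f x < t] by move=> x /=;
  move=> /le_lt_trans; exact.
move=> /(_ h0) h1; apply: filterS (filterI h1 h2) => n [{}h1 {}h2].
rewrite !signed_level_sublevel//.
have h3 : m [set x | f x < t] <= m [set x | f x <= t].
  by apply: (rtm_le rm); [left|right|move=> x /ltW].
have h4 : ms n K <= ms n [set x | f x <= t].
  apply: (rtm_le (rm_ n)); [right|right|by move=> x /Kt /ltW] => //.
  exact: metric_compact_closed.
have h5 : m [set x | f x <= s] <= m [set x | f x < t] by apply: (rtm_le rm);
  [right|left|].
by split; lra.
Qed.

(** Level sets lose compactness at 0, so the integral is split there: superlevel sets interlace to
    the right, sublevel sets to the left. The bound [B] on the masses controls the error near the
    ends of the two intervals. *)
Lemma vague_cvg_qint k ms m f (B : R) : (forall n, rtm k (ms n)) -> rtm k m ->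
  (forall n, ms n setT <= B) -> vague_cvg ms m -> C0 f ->
  (k = Deficient -> forall x, 0 <= f x) -> forall e, 0 < e ->
  \forall n \near \oo, `|qint (EFin \o ms n) f - qint (EFin \o m) f| <= e.
Proof.
move=> rm_ rm mB mm C0f f0 e e0; have [cf _] := C0f.
have [C C_gt0 fC] := C0_bounded C0f; have C_ge0 := ltW C_gt0.
pose B' := Num.max B (m setT).
have bounds n : 0 <= ms n setT <= B' by rewrite (rtm_ge0 (rm_ n)) le_max mB.
have bound : 0 <= m setT <= B' by rewrite (rtm_ge0 rm) le_max lexx orbT.
(* [signed_level] jumps up at 0 and is not monotone across it; [lo] agrees with it for [t < 0] and
   is monotone everywhere. *)
pose lo m t := level m f t - m setT.
have lod m' : rtm k m' -> nonincreasing_fun (lo m').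
  by move=> rm' s t st; rewrite lerD2r; exact: (level_nonincreasing rm' cf).
have qE m' : rtm k m' ->
    qint (EFin \o m') f = J (lo m') (- C) 0 + J (level m' f) 0 C.
  move=> rm'; have li a b := signed_level_integrable a b rm' cf.
  rewrite (qint_signed_level rm' cf C_ge0 fC) (@integral_itv_split _ _ (- C) 0 C)//;
    last by lra.
  congr (_ + _); apply: eq_integral_itvco => //.
  - exact: nonincreasing_integrable (lod _ rm').
  - by move=> t /andP[_ t0]; rewrite /signed_level t0.
  - exact: nonincreasing_integrable (level_nonincreasing rm' cf).
  - by move=> t /andP[t0 _]; rewrite /signed_level ltNge t0 subr0.
have e2 : 0 < e / 2 by lra.
have level_bound m' t : rtm k m' -> m' setT <= B' -> `|level m' f t| <= B'.
  by move=> rm' mB'; have /andP[l0 l1] := level_bounds f t rm';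
    rewrite ger0_norm// (le_trans l1).
have lo_bound m' t : rtm k m' -> m' setT <= B' -> `|lo m' t| <= B'.
  move=> rm' mB'; have /andP[l0 l1] := level_bounds f t rm'.
  by rewrite /lo ler_norml; apply/andP; split; lra.
have Cneg : - C < 0 by lra.
have loE m' t : t < 0 -> lo m' t = signed_level m' f t by move=> t0;
  rewrite /signed_level t0.
have h1 : \forall n \near \oo, `|J (lo (ms n)) (- C) 0 - J (lo m) (- C) 0| <= e / 2.
  apply: (@nonincreasing_integral_cvg _ (fun n => lo (ms n)) (lo m) _ _ B' Cneg) => //.
  - by move=> n; exact: lod.
  - exact: lod.
  - by move=> n t; apply: lo_bound => //; case/andP: (bounds n).
  - by move=> t; apply: lo_bound => //; case/andP: bound.
  - move=> s t _ st t0 d d0.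
    have s0 := lt_trans st t0.
    have H : \forall n \near \oo, signed_level (ms n) f t <= signed_level m f s + d /\
        signed_level m f t <= signed_level (ms n) f s + d.
      case: k rm_ rm f0 {lod qE level_bound lo_bound} => rm_ rm f0.
        exact: vague_cvg_sublevel.
      by apply: nearW => n; rewrite !(signed_level_ge0 _ (f0 erefl))// add0r ltW.
    by apply: filterS H => n; rewrite !loE.
have h2 : \forall n \near \oo, `|J (level (ms n) f) 0 C - J (level m f) 0 C| <= e / 2.
  apply: (@nonincreasing_integral_cvg _ (fun n =>
    level (ms n) f) (level m f) _ _ B' C_gt0) => //.
  - by move=> n; exact: level_nonincreasing (rm_ n) cf.
  - exact: level_nonincreasing rm cf.
  - by move=> n t; apply: level_bound => //; case/andP: (bounds n).
  - by move=> t; apply: level_bound => //; case/andP: bound.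
  - move=> s t s0 st _ d d0; apply: vague_cvg_level => //; last exact: rtm_Deficient rm.
    by move=> n; exact: rtm_Deficient (rm_ n).
apply: filterS (filterI h1 h2) => n [{}h1 {}h2]; rewrite (qE _ (rm_ n)) (qE _ rm).
move: h1 h2; rewrite !ler_norml => /andP[? ?] /andP[? ?].
by apply/andP; split; lra.
Qed.

Hypothesis X_loc_compact : locally_compact [set: X].

(** The function and its height [r] do not depend on the measure, so closeness of integrals against
    this one function yields comparisons on sets, with errors divided by [r]. *)
Lemma qint_sandwich k K U : compact K -> open U -> K `<=` U ->
  exists f (r : R), [/\ 0 < r, Lip_c k 1 f & forall k' m, rtm k' m ->
    r * m K <= qint (EFin \o m) f <= r * m U].
Proof.
move=> cK oU KU; have [f [r [r0 Lf f0r fK fU]]] := lip_urysohn X_loc_compact k cK oU KU.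
have f0 x : 0 <= f x by case/andP: (f0r x).
have fr x : `|f x| <= r by rewrite ger0_norm//; case/andP: (f0r x).
exists f, r; split => // k' m rm; have cf : continuous f by case: (Lip_c_C0 Lf).
have li a b := signed_level_integrable a b rm cf.
have ci (c : R) a b := cst_integrable_itv a b c.
rewrite (qint_signed_level rm cf (ltW r0) fr) (@integral_itv_split _ _ (- r) 0 r)//;
  [|lra|exact: ltW].
rewrite (@eq_integral_itvco _ (signed_level m f) (fun=> 0) (- r) 0)//; last first.
  by move=> t /andP[_ t0]; rewrite signed_level_ge0.
rewrite integral_itv_cst ?mulr0 ?add0r; last by lra.
have E c : r * c = J (fun=> c) 0 r by rewrite integral_itv_cst ?subr0// ltW.
rewrite !E; apply/andP; split; apply: integral_itvco_le => // t /andP[t0 tr];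
  rewrite /signed_level ltNge t0 subr0; apply: (rtm_le rm) => //.
- by right; exact: metric_compact_closed.
- by left; exact: open_superlevel.
- by move=> x /fK /= ->.
- by left; exact: open_superlevel.
- by left.
- by move=> x /= tx; apply: fU; exact: le_lt_trans tx.
Qed.

Lemma rtm_eq_open k m m' : rtm k m -> rtm k m' ->
  (forall U, open U -> m U <= m' U) -> (forall U, open U -> m' U <= m U) -> m = m'.
Proof.
move=> rm rm' le1 le2; apply/funext => A.
have H n n' : rtm k n -> rtm k n' -> (forall U, open U -> n U <= n' U) -> n A <= n' A.
  move=> rn rn' le; have [[oA|cA]|nA] := pselect (open A \/ closed A); first exact: le.
    apply/ler_addgt0Pr => e e0; have [U [oU AU] Ue] := rtm_outer rn' cA e0.
    apply: (@le_trans _ _ (n U)); first by apply: (rtm_le rn) => //; [right|left].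
    by apply: (le_trans (le U oU)); exact: ltW.
  by rewrite (rtm_out rn)// (rtm_out rn').
by apply/eqP; rewrite eq_le (H m m')// (H m' m).
Qed.

Lemma qint_Lip_inj k m m' : rtm k m -> rtm k m' ->
  (forall f, Lip_c k 1 f -> qint (EFin \o m) f = qint (EFin \o m') f) -> m = m'.
Proof.
have H n n' : rtm k n -> rtm k n' ->
    (forall f, Lip_c k 1 f -> qint (EFin \o n) f = qint (EFin \o n') f) ->
    forall U, open U -> n U <= n' U.
  move=> rn rn' nn U oU; apply/ler_addgt0Pr => e e0.
  have [K [cK KU] Ke] := rtm_inner rn oU e0; apply: (le_trans (ltW Ke)); rewrite lerD2r.
  have [f [r [r0 Lf sand]]] := qint_sandwich k cK oU KU.
  rewrite -(ler_pM2l r0); have /andP[+ _] := sand _ _ rn;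
    rewrite (nn f Lf) => /le_trans; apply.
  by have /andP[] := sand _ _ rn'.
move=> rm rm' mm; apply: (rtm_eq_open rm rm'); apply: H => // f Lf; exact/esym/mm.
Qed.

Lemma Lip_cvg_vague k ms m : (forall n, rtm k (ms n)) -> rtm k m ->
  (forall f, Lip_c k 1 f -> forall e, 0 < e ->
    \forall n \near \oo, `|qint (EFin \o ms n) f - qint (EFin \o m) f| <= e) ->
  vague_cvg ms m.
Proof.
move=> rm_ rm mm U oU e e0; split; last first.
  move=> K cK KU; have [f [r [r0 Lf sand]]] := qint_sandwich k cK oU KU.
  apply: filterS (mm f Lf _ (mulr_gt0 r0 e0)) => n; rewrite ler_norml => /andP[_ h].
  have /andP[h1 _] := sand _ _ (rm_ n); have /andP[_ h2] := sand _ _ rm.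
  by rewrite -(ler_pM2l r0) mulrDr; lra.
have e2 : 0 < e / 2 by lra.
have [K [cK KU] Ke] := rtm_inner rm oU e2.
(* The lower half of [vague_cvg] asks for a compact witness, so the test function is confined to the
   interior of a compact [L] inside [U]. *)
have [L [cL LU] KL] := compact_nbhd X_loc_compact cK oU KU.
have oL := @open_interior _ L.
have [f [r [r0 Lf sand]]] := qint_sandwich k cK oL KL.
exists L => //; apply: filterS (mm f Lf _ (mulr_gt0 r0 e2)) => n;
  rewrite ler_norml => /andP[h _].
have /andP[_ h1] := sand _ _ (rm_ n); have /andP[h2 _] := sand _ _ rm.
have h3 : ms n L° <= ms n L.
  apply: (rtm_le (rm_ n)); [by left|right|exact: interior_subset].
  exact: metric_compact_closed.
suff : m K <= ms n L° + e / 2 by lra.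
by rewrite -(ler_pM2l r0) mulrDr; lra.
Qed.

(** * The limit of a Cauchy sequence of measures *)

Section limit.
Variables (k : kind) (ms : nat -> set X -> R) (B : R).
Hypotheses (rm_ : forall n, rtm k (ms n)) (ms_B : forall n, ms n setT <= B).
Hypothesis ms_cauchy : forall K U, compact K -> open U -> K `<=` U ->
  forall e : R, 0 < e -> exists N, forall i j, (N <= i)%N -> (N <= j)%N ->
    ms i K <= ms j U + e.

Let low U := [set v : R | exists2 K, compact K /\ K `<=` U &
  \forall n \near \oo, v <= ms n K].

(* The supremum over the compact [K] inside [U] of the lower limit of [ms n K] *)
Let lim_open U : R := sup (low U).

Definition vague_limit A : R :=
  if `[< open A >] then lim_open A
  else if `[< closed A >] then inf [set lim_open U | U in [set U | open U /\ A `<=` U]]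
  else 0.

Let oc K : compact K -> open K \/ closed K.
Proof. by right; exact: metric_compact_closed. Qed.

Let low0 U : low U 0.
Proof.
exists set0; first by split; [exact: compact0|exact: sub0set].
by apply: nearW => n; exact: rtm_ge0 (rm_ n) _.
Qed.

Let low_sup U : has_sup (low U).
Proof.
split; first by exists 0.
exists B => v [K _ /filter_ex[n /le_trans]]; apply.
exact: le_trans (rtm_leT _ (rm_ n)) (ms_B n).
Qed.

Let lim_open_ge K U v : compact K -> K `<=` U ->
  (\forall n \near \oo, v <= ms n K) -> v <= lim_open U.
Proof. by move=> cK KU h; apply: (ub_le_sup (low_sup U).2); exists K. Qed.

Let lim_open_inner U e : 0 < e -> exists2 K, compact K /\ K `<=` U &
  \forall n \near \oo, lim_open U - e <= ms n K.
Proof.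
move=> e0; have [v [K KU h] ve] := sup_adherent e0 (low_sup U).
by exists K => //; apply: filterS h => n; apply: le_trans; exact: ltW.
Qed.

(** The Cauchy property enters here. For a compact [L] between [K] and [U], every late [ms i K - e]
    is an eventual lower bound of [ms j L], hence at most the lower limit defining [lim_open U]. *)
Let lim_open_upper K U e : compact K -> open U -> K `<=` U -> 0 < e ->
  \forall n \near \oo, ms n K <= lim_open U + e.
Proof.
move=> cK oU KU e0; have [L [cL LU] KL] := compact_nbhd X_loc_compact cK oU KU.
have [N mN] := ms_cauchy cK (@open_interior _ L) KL e0.
exists N => // i /= Ni; rewrite -lerBlDr; apply: (lim_open_ge cL LU).
exists N => // j /= Nj; rewrite lerBlDr; apply: le_trans (mN i j Ni Nj) _;
  rewrite lerD2r.
apply: (rtm_le (rm_ j)); [by left; exact: open_interior|exact: oc|exact: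
  interior_subset].
Qed.

Let lim_open_le U V : U `<=` V -> lim_open U <= lim_open V.
Proof.
move=> UV; apply: ge_sup; first by exists 0.
by move=> v [K [cK KU]]; apply: lim_open_ge => //; exact: subset_trans UV.
Qed.

Let lim_open_ge0 U : 0 <= lim_open U.
Proof. exact: (ub_le_sup (low_sup U).2 (low0 U)). Qed.

Let vague_limitE U : open U -> vague_limit U = lim_open U.
Proof. by move=> oU; rewrite /vague_limit asboolT. Qed.

Let inf_set F : has_inf [set lim_open U | U in [set U | open U /\ F `<=` U]].
Proof.
split; first by exists (lim_open setT), setT => //; split;
  [exact: openT|exact: subsetT].
by exists 0 => _ [U _ <-]; exact: lim_open_ge0.
Qed.

Let limit_le F U : closed F -> open U -> F `<=` U -> vague_limit F <= lim_open U.
Proof.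
move=> cF oU FU; have [oF|nF] := pselect (open F).
  by rewrite vague_limitE//; exact: lim_open_le.
rewrite /vague_limit (asboolF nF) asboolT//; apply: (ge_inf (inf_set F).2).
by exists U.
Qed.

Let limit_outer F e : closed F -> 0 < e ->
  exists2 U, open U /\ F `<=` U & lim_open U < vague_limit F + e.
Proof.
move=> cF e0; have [oF|nF] := pselect (open F).
  by exists F; [split|rewrite vague_limitE// ltrDl].
have [_ [U FU <-] Ue] := inf_adherent e0 (inf_set F).
by exists U => //; rewrite /vague_limit (asboolF nF) asboolT.
Qed.

Let limit_compact_ge K v : compact K -> (\forall n \near \oo, v <= ms n K) -> v <=
  vague_limit K.
Proof.
move=> cK h; apply/ler_addgt0Pr => e e0.
have [U [oU KU] Ue] := limit_outer (metric_compact_closed cK) e0.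
by apply: le_trans (ltW Ue); exact: lim_open_ge h.
Qed.

Let additive_open U V : open U -> open V -> U `&` V = set0 ->
  lim_open (U `|` V) = lim_open U + lim_open V.
Proof.
move=> oU oV UV; apply/eqP; rewrite eq_le; apply/andP; split;
  apply/ler_addgt0Pr => e e0.
  have e3 : 0 < e / 3 by lra.
  have [K [cK KUV] h] := lim_open_inner (U `|` V) e3.
  have [K1 [K2 [cK1 cK2 KU KV KE]]] := compact_setU_split cK oU oV UV KUV.
  have KI : K1 `&` K2 = set0 by rewrite -subset0 -UV; exact: setISS.
  have hU := lim_open_upper cK1 oU KU e3; have hV := lim_open_upper cK2 oV KV e3.
  have [n [hn [hUn hVn]]] := filter_ex (filterI h (filterI hU hV)).
  move: hn; rewrite KE (rtm_add (rm_ n) (additive_pair_compact _ cK1 cK2 KI)).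
  by move=> hn; lra.
have e2 : 0 < e / 2 by lra.
have [K [cK KU] hK] := lim_open_inner U e2; have [L [cL LV] hL] := lim_open_inner V e2.
have KL : K `&` L = set0 by rewrite -subset0 -UV; exact: setISS.
suff : lim_open U - e / 2 + (lim_open V - e / 2) <= lim_open (U `|` V) by lra.
apply: (lim_open_ge (compactU cK cL) (setUSS KU LV)).
apply: filterS (filterI hK hL) => n [{}hK {}hL].
by rewrite (rtm_add (rm_ n) (additive_pair_compact _ cK cL KL)) lerD.
Qed.

Let limit_additive A C : compact A -> compact C -> A `&` C = set0 ->
  vague_limit (A `|` C) = vague_limit A + vague_limit C.
Proof.
move=> cA cC AC; have clA := metric_compact_closed cA;
  have clC := metric_compact_closed cC.
have AnC : A `<=` ~` C by move=> x Ax Cx; have : (A `&` C) x by []; rewrite AC.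
have [L [cL LC] AL] := compact_nbhd X_loc_compact cA (closed_openC clC) AnC.
have oL := @open_interior _ L; have onL := closed_openC (metric_compact_closed cL).
have CL : C `<=` ~` L by move=> x Cx Lx; exact: LC Cx.
have dL V W : (L° `&` V) `&` (~` L `&` W) = set0.
  by rewrite -subset0 => x [[/interior_subset Lx _] [nLx _]].
apply/eqP; rewrite eq_le; apply/andP; split; apply/ler_addgt0Pr => e e0.
  have e2 : 0 < e / 2 by lra.
  have [U [oU AU] Ue] := limit_outer clA e2; have [V [oV CV] Ve] := limit_outer clC e2.
  have oLU := openI oL oU; have onLV := openI onL oV.
  have h := limit_le (closedU clA clC) (openU oLU onLV).
  apply: (@le_trans _ _ (lim_open ((L° `&` U) `|` (~` L `&` V)))).
    by apply: h; apply: setUSS; rewrite subsetI.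
  rewrite (additive_open oLU onLV (dL _ _)).
  have := lim_open_le (@subIsetr _ L° U); have := lim_open_le (@subIsetr _ (~` L) V);
    lra.
have [W [oW ACW] We] := limit_outer (closedU clA clC) e0.
have oLW := openI oL oW; have onLW := openI onL oW.
apply: (@le_trans _ _ (lim_open (L° `&` W) + lim_open (~` L `&` W))).
  apply: lerD; apply: limit_le => // x xAC; split.
  - exact: AL.
  - by apply: ACW; left.
  - exact: CL.
  - by apply: ACW; right.
rewrite -(additive_open oLW onLW (dL _ _)); apply: le_trans (ltW We).
by apply: lim_open_le; rewrite -setIUl; exact: subIsetr.
Qed.

Lemma vague_limit_cvg : vague_cvg ms vague_limit.
Proof.
move=> U oU e e0; rewrite (vague_limitE oU); split; last first.
  by move=> K cK KU; exact: lim_open_upper.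
have [K KU h] := lim_open_inner U e0; exists K => //.
by apply: filterS h => n; rewrite lerBlDr.
Qed.

Lemma vague_limit_rtm : rtm k vague_limit.
Proof.
have rD : rtm Deficient vague_limit.
  apply: rtm_open_intro.
  - move=> A; rewrite /vague_limit; case: ifP => // _; case: ifP => // _.
    by apply: lb_le_inf; [exact: (inf_set A).1|move=> _ [U _ <-]].
  - by move=> A nA; rewrite /vague_limit !asboolF// => ?; apply: nA; [right|left].
  - by move=> U V oU oV UV; rewrite !vague_limitE//; exact: lim_open_le.
  - by move=> F U cF oU FU; rewrite (vague_limitE oU); exact: limit_le.
  - by move=> A C [AC [cA cC]]; exact: limit_additive.
  - move=> U e oU e0; have e2 : 0 < e / 2 by lra.
    have [K KU h] := lim_open_inner U e2; exists K => //; rewrite (vague_limitE oU).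
    by have := limit_compact_ge KU.1 h; lra.
  - move=> F e cF e0; have [U [oU FU] Ue] := limit_outer cF e0.
    by exists U => //; rewrite (vague_limitE oU).
(* [K] is thickened to a compact [D] inside a nearly optimal neighbourhood [W]. Additivity of [ms n]
   on [D] and [L° \ D] is available for [Plain], and [L° \ D] lies in the compact [L \ D°] inside
   [U \ K], so both parts obey [lim_open_upper]. *)
case: k rm_ => rP //; apply: rtm_Plain => // K U cK oU KU.
have clK := metric_compact_closed cK.
have oUK : open (U `\` K) by apply: openI => //; exact: closed_openC.
rewrite (vague_limitE oU) (vague_limitE oUK); apply/ler_addgt0Pr => e e0.
have e4 : 0 < e / 4 by lra.
have [W [oW KW] We] := limit_outer clK e4.
have [D [cD DWU] KD] : exists2 D, compact D /\ D `<=` W `&` U & K `<=` D°.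
  by apply: (compact_nbhd X_loc_compact) => //; [exact: openI|rewrite subsetI].
have [C [cC CU] hC] := lim_open_inner U e4.
have CDU : C `|` D `<=` U by rewrite subUset; split => // x /DWU[].
have [L [cL LU] CDL] := compact_nbhd X_loc_compact (compactU cC cD) oU CDU.
have oL := @open_interior _ L.
have clD := metric_compact_closed cD.
have cLD : compact (L `\` D°) by apply: compact_closedI => //;
  exact: open_closedC (@open_interior _ D).
have LDU : L `\` D° `<=` U `\` K by move=> x [Lx nDx]; split; [exact: LU|move=> /KD].
have DW : D `<=` W by move=> x /DWU[].
have hD := lim_open_upper cD oW DW e4.
have hL := lim_open_upper cLD oUK LDU e4.
have [n [hn [hDn hLn]]] := filter_ex (filterI hC (filterI hD hL)).
have oLD : open (L° `\` D) by apply: openI => //; exact: closed_openC.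
have DL : D `<=` L° by move=> x Dx; apply: CDL; right.
have LE : D `|` (L° `\` D) = L° by rewrite setDUK.
have AP : additive_pair Plain D (L° `\` D).
  split; first by rewrite setDIK.
  by rewrite LE; split; [right|left|left].
have h1 : ms n C <= ms n L°.
  by apply: (rtm_le (rP n)); [exact: oc|left|move=> x Cx; apply: CDL; left].
have h2 := rtm_add (rP n) AP; rewrite LE in h2.
have h3 : ms n (L° `\` D) <= ms n (L `\` D°).
  by apply: (rtm_le (rP n)); [left|exact: oc|apply: setDSS; exact: interior_subset].
lra.
Qed.

End limit.
End vague_convergence.

(** * Fixed points and representability *)

Section fixed_points.
Context {R : realType} {X : metricType R}.
Implicit Types (m : set X -> R) (f : X -> R) (k : kind) (D e : R).

(** A real-valued bound on [dKR]; it avoids extended arithmetic with infinite distances. *)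
Definition Lip_close k D m m' := forall f, Lip_c k 1 f ->
  `|qint (EFin \o m) f - qint (EFin \o m') f| <= D.

Lemma Lip_close_dKR k D m m' :
  Lip_close k D m m' <-> (dKR k (EFin \o m) (EFin \o m') <= D%:E)%E.
Proof.
split=> [mm|/ereal_supP mm f Lf]; first by apply/ereal_supP => _ [f Lf <-];
  rewrite lee_fin mm.
by rewrite -lee_fin; apply: mm; exists f.
Qed.

Lemma dKR_ge0 k m m' : (0 <= dKR k (EFin \o m) (EFin \o m'))%E.
Proof.
apply: le_ereal_sup_tmp; exists (`|qint (EFin \o m) (cst 0) - qint (EFin \o m') (cst
  0)|%:E).
  by exists (cst 0) => //; exact: Lip_c_cst0.
by rewrite lee_fin.
Qed.

Lemma dKR_fine k m m' : (dKR k (EFin \o m) (EFin \o m') < +oo)%E ->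
  0 <= fine (dKR k (EFin \o m) (EFin \o m')) /\
  Lip_close k (fine (dKR k (EFin \o m) (EFin \o m'))) m m'.
Proof.
move=> fin; have d0 := dKR_ge0 k m m'; split; first exact: fine_ge0.
by apply/Lip_close_dKR; rewrite fineK// ge0_fin_numE.
Qed.

Lemma Lip_close_trans k D1 D2 m1 m2 m3 : Lip_close k D1 m1 m2 ->
  Lip_close k D2 m2 m3 -> Lip_close k (D1 + D2) m1 m3.
Proof.
move=> h1 h2 f Lf; apply: le_trans (ler_distD (qint (EFin \o m2) f) _ _) _.
exact: lerD (h1 f Lf) (h2 f Lf).
Qed.

Lemma Lip_close_sym k D m1 m2 : Lip_close k D m1 m2 -> Lip_close k D m2 m1.
Proof. by move=> h f Lf; rewrite distrC h. Qed.

Hypothesis X_loc_compact : locally_compact [set: X].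

Lemma Lip_close_small k m m' : rtm k m -> rtm k m' ->
  (forall e, 0 < e -> Lip_close k e m m') -> m = m'.
Proof.
move=> rm rm' mm; apply: (qint_Lip_inj X_loc_compact rm rm') => f Lf.
apply/eqP; rewrite -subr_eq0 -normr_le0; apply/ler_addgt0Pr => e e0.
by rewrite add0r; exact: mm.
Qed.

Section markov.
Variables (k : kind) (q : nat -> set X -> set X) (alpha : nat -> R) (s : R).
Hypotheses (q_alpha : transformation_system k q alpha)
  (q_s : system_contractivity_factor k q s) (s_lt1 : s < 1).

Local Notation S := (rmarkov q alpha).

Lemma contractivity_factor_gt0 : 0 < s.
Proof. by have [si [/andP[si0 _] _] /(lt_le_trans si0)] := q_s 0%N. Qed.

Let s0 := contractivity_factor_gt0.

Let sX n : 0 <= s ^+ n. Proof. by rewrite exprn_ge0// ltW. Qed.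

Lemma exprn_small D e : 0 <= D -> 0 < e ->
  \forall n \near \oo, s ^+ n * D <= e.
Proof.
move=> D0 e0; have sn : `|s| < 1 by rewrite ger0_norm// ltW.
have D1 : 0 < D + 1 by lra.
have /cvgrPdist_le/(_ _ (divr_gt0 e0 D1)) := cvg_expr sn; apply: filterS => n.
rewrite sub0r normrN ger0_norm// ler_pdivlMr//; apply: le_trans.
by apply: ler_wpM2l => //; rewrite lerDl.
Qed.

Lemma Lip_close_markov D m m' : rtm k m -> rtm k m' -> 0 <= D ->
  Lip_close k D m m' -> Lip_close k (s * D) (S m) (S m').
Proof. exact: rmarkov_contracting. Qed.

Lemma markov_fixed_point_unique D m m' : rtm k m -> rtm k m' -> 0 <= D ->
  Lip_close k D m m' -> S m = m -> S m' = m' -> m = m'.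
Proof.
move=> rm rm' D0 mm Sm Sm'; apply: (Lip_close_small rm rm') => e e0.
have close n : Lip_close k (s ^+ n * D) m m'.
  elim: n => [|n IH]; first by rewrite expr0 mul1r.
  rewrite -Sm -Sm' exprS -mulrA; apply: Lip_close_markov => //.
  exact: mulr_ge0.
have [n sn] := filter_ex (exprn_small D0 e0).
by move=> f Lf; apply: le_trans sn; exact: close.
Qed.

Lemma iter_markov_rtm m n : rtm k m -> rtm k (iter n S m).
Proof. by move=> rm; elim: n => //= n; exact: (rmarkov_rtm X_loc_compact q_alpha). Qed.

Lemma iter_markov_setT m n : rtm k m -> iter n S m setT <= m setT.
Proof.
move=> rm; elim: n => //= n; apply: le_trans.
exact: (rmarkov_setT X_loc_compact q_alpha) (iter_markov_rtm n rm).
Qed.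

Lemma iter_markov_close D m m' n : rtm k m -> rtm k m' -> 0 <= D ->
  Lip_close k D m m' -> Lip_close k (s ^+ n * D) (iter n S m) (iter n S m').
Proof.
move=> rm rm' D0 mm; elim: n => [|n IH]; first by rewrite expr0 mul1r.
rewrite exprS -mulrA; apply: Lip_close_markov => //; try exact: iter_markov_rtm.
exact: mulr_ge0.
Qed.

Lemma markov_fixed_point_exists D m0 : rtm k m0 -> 0 <= D ->
  Lip_close k D m0 (S m0) -> exists m, [/\ rtm k m, S m = m &
    forall e, 0 < e -> exists n, Lip_close k e (iter n S m0) m].
Proof.
move=> rm0 D0 mS; pose ms n := iter n S m0.
have rm n : rtm k (ms n) by exact: iter_markov_rtm.
(* The sum of the geometric series; the identity [D + s * B = B] replaces the summation in the
   induction. *)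
pose B := D / (1 - s); have B0 : 0 <= B by rewrite divr_ge0// subr_ge0 ltW.
have DB : D + s * B = B by rewrite /B; field; rewrite subr_eq0 gt_eqF.
have close0 j : Lip_close k B m0 (ms j).
  elim: j => [|j IH]; first by move=> f _; rewrite subrr normr0.
  rewrite -DB; apply: Lip_close_trans mS _; exact: Lip_close_markov (rm j) B0 IH.
have close n i : (n <= i)%N -> Lip_close k (s ^+ n * B) (ms n) (ms i).
  move=> ni; rewrite -(subnKC ni) /ms iterD.
  apply: iter_markov_close => //; [exact: rm|exact: close0].
have small e : 0 < e -> \forall n \near \oo, s ^+ n * B <= e by exact: exprn_small.
have cauchy K U : compact K -> open U -> K `<=` U -> forall e, 0 < e ->
    exists N, forall i j, (N <= i)%N -> (N <= j)%N -> ms i K <= ms j U + e.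
  move=> cK oU KU e e0; have [f [r [r0 Lf sand]]] :=
    qint_sandwich X_loc_compact k cK oU KU.
  (* Both [ms i] and [ms j] are compared with [ms N]; the two errors add up to [r * e], and the
     factor [r] comes from the sandwich. *)
  have er : 0 < r * e / 2 by rewrite divr_gt0// mulr_gt0.
  have [N sN] := filter_ex (small _ er); exists N => i j Ni Nj.
  have /andP[h1 _] := sand _ _ (rm i); have /andP[_ h2] := sand _ _ (rm j).
  have := Lip_close_trans (Lip_close_sym (close N i Ni)) (close N j Nj) Lf.
  rewrite ler_norml => /andP[_ h3]; rewrite -(ler_pM2l r0) mulrDr; lra.
have msB n : ms n setT <= m0 setT by exact: iter_markov_setT.
pose m := vague_limit ms.
have rml : rtm k m := vague_limit_rtm X_loc_compact rm msB cauchy.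
have cvg := vague_limit_cvg X_loc_compact rm msB cauchy.
have lim n : Lip_close k (s ^+ n * B) (ms n) m.
  move=> f Lf; apply/ler_addgt0Pr => e e0.
  have f0 : k = Deficient -> forall x, 0 <= f x by case: Lf.
  have h := vague_cvg_qint rm rml msB cvg (Lip_c_C0 Lf) f0 e0.
  have [i [hi ni]] := filter_ex (filterI h (nbhs_infty_ge n)).
  apply: le_trans (ler_distD (qint (EFin \o ms i) f) _ _) _.
  exact: lerD (close n i ni f Lf) hi.
exists m; split; first exact: rml.
  (* Both sides are compared with [ms n.+1], the image of [ms n] under the operator. *)
  apply: Lip_close_small; [exact: (rmarkov_rtm X_loc_compact q_alpha)|exact: rml|].
  move=> e e0; have e2 : 0 < e / 2 by lra.
  have [n sn] := filter_ex (small _ e2).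
  have p0 : 0 <= s ^+ n * B by exact: mulr_ge0.
  have h1 := Lip_close_sym (Lip_close_markov (rm n) rml p0 (lim n)).
  have h2 := lim n.+1; move=> f Lf; apply: (le_trans (Lip_close_trans h1 h2 Lf)).
  rewrite exprS -mulrA; have : s * (s ^+ n * B) <= s ^+ n * B by rewrite ler_piMl// ltW.
  lra.
move=> e e0; have [n sn] := filter_ex (small _ e0); exists n => f Lf.
exact: le_trans (lim n f Lf) sn.
Qed.

End markov.
End fixed_points.

(** * Approximation by convex combinations of simple measures *)

Section representability.
Context {R : realType} {X : metricType R}.
Implicit Types (m : set X -> R) (f : X -> R) (k : kind) (D e : R).

Definition zero_one m : Prop := forall A, m A = 0 \/ m A = 1.

(* Convex combinations, with the remaining weight on the zero measure *)
Definition subconvex_hull k m : Prop := exists (T : finType) (w : T -> R)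
    (n : T -> set X -> R),
  [/\ forall t, 0 <= w t, \sum_t w t <= 1,
      forall t, rtm k (n t) /\ zero_one (n t)
    & m = fun A => \sum_t w t * n t A].

Lemma simple_rtm k m : rtm k m -> zero_one m -> simple_tm k (EFin \o m).
Proof.
move=> rm m01; split; first by have [] := (finite_tmP k (EFin \o m)).2 (ex_intro2 _ _
  m rm erefl).
by move=> A /=; case: (m01 A) => ->; [left|right].
Qed.

Lemma subconvex_hull_convex k m : subconvex_hull k m ->
  convex_hull (simple_tm k) (EFin \o m).
Proof.
move=> [T [w [n [w0 w1 sn ->]]]].
(* Index [ord0] carries the missing weight. The zero measure placed there counts as simple, since it
   takes only the value 0. *)
exists #|T|.+1, (fun i => if unlift ord0 i is Some j then w (enum_val j) else 1 -
  \sum_t w t),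
  (fun i => if unlift ord0 i is Some j then EFin \o n (enum_val j) else EFin \o fun=>
    0).
split.
- by move=> i; case: unlift => [j|]; rewrite ?subr_ge0.
- rewrite big_ord_recl unlift_none; under [X in _ + X]eq_bigr do rewrite liftK.
  by rewrite -(big_enum_val w)/= subrK.
- move=> i; case: unlift => [j|]; apply: simple_rtm.
  + exact: (sn _).1.
  + exact: (sn _).2.
  + exact: rtm_cst0.
  + by left.
- apply/funext => A /=; rewrite big_ord_recl unlift_none/= mule0 add0e.
  under [RHS]eq_bigr do rewrite liftK/=.
  by rewrite -(big_enum_val (fun t => (w t)%:E * (n t A)%:E)%E)/= -sumEFin.
Qed.

(** A closed set either has an open neighbourhood of measure 0 or only neighbourhoods of measure 1;
    outer regularity decides its value in both cases. For adjoints, the values on open sets are the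
    explicit ones. *)
Lemma zero_one_open k m : rtm k m -> (forall U, open U -> m U = 0 \/ m U = 1) ->
  zero_one m.
Proof.
move=> rm m01 A; have [[oA|cA]|nA] := pselect (open A \/ closed A); first exact: m01.
  have [[U [oU AU] mU]|nU] := pselect (exists2 U, open U /\ A `<=` U & m U = 0).
    left; apply/eqP; rewrite eq_le (rtm_ge0 rm) andbT -mU; apply: (rtm_le rm) => //;
      by [left|right].
  right; have m1 U : open U -> A `<=` U -> m U = 1.
    by move=> oU AU; case: (m01 U oU) => // mU; case: nU; exists U.
  apply/eqP; rewrite eq_le -{1}(m1 setT openT (@subsetT _ A)) (rtm_leT _ rm)/=.
  apply/ler_addgt0Pr => e e0; have [U [oU AU] /ltW] := rtm_outer rm cA e0.
  by rewrite m1.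
by left; exact: rtm_out rm A nA.
Qed.

Lemma rpoint_mass_zero_one y : zero_one (@rpoint_mass R X y).
Proof.
move=> A; rewrite /rpoint_mass; case: ifP => _; last by left.
by rewrite indicE; case: (y \in A); [right|left].
Qed.

Lemma subconvex_hull_point k y : subconvex_hull k (rpoint_mass y).
Proof.
exists unit, (fun=> 1), (fun=> rpoint_mass y); split => //.
- by rewrite big_const card_unit /= addr0.
- by move=> _; split; [exact: rpoint_mass_rtm|exact: rpoint_mass_zero_one].
- by apply/funext => A; rewrite big_const card_unit /= addr0 mul1r.
Qed.

Lemma rtm_sum_fin k (T : finType) (w : T -> R) (n : T -> set X -> R) :
  (forall t, 0 <= w t) -> (forall t, rtm k (n t)) -> rtm k (fun A =>
    \sum_t w t * n t A).
Proof.
move=> w0 rn; rewrite (_ : (fun A => _) =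
    fun A => \sum_(i < #|T|) w (enum_val i) * n (enum_val i) A); first exact: rtm_sum.
by apply/funext => A; rewrite -(big_enum_val (fun t => w t * n t A)).
Qed.

Lemma subconvex_hull_rtm k m : subconvex_hull k m -> rtm k m.
Proof. by move=> [T [w [n [w0 _ sn ->]]]]; apply: rtm_sum_fin => // t;
  have [] := sn t. Qed.

Hypothesis X_loc_compact : locally_compact [set: X].

Section markov.
Variables (k : kind) (q : nat -> set X -> set X) (alpha : nat -> R).
Hypothesis q_alpha : transformation_system k q alpha.

Local Notation S := (rmarkov q alpha).

(** An adjoint of a simple measure is again simple or zero, so distributing the sum stays in the
    hull. Agreement on open sets is enough for quasi-integrals and avoids interchanging sums with
    the infimum that defines the adjoint on noncompact closed sets. *)
Lemma subconvex_hull_markov_sum m N : subconvex_hull k m ->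
  exists2 m', subconvex_hull k m' &
    forall U, open U -> m' U = markov_sum q alpha m N U.
Proof.
move=> [T [w [n [w0 w1 sn ->]]]]; have [qI a0 a1] := q_alpha.
have a1' := partial_weights_le1 N a0 a1.
(* Pairs of a transformation and an old summand index the new combination; this is why the hull
   allows any finite index type. *)
exists (fun A => \sum_(p : 'I_N * T) (alpha p.1 * w p.2) * radjoint (q p.1) (n p.2) A).
  exists ('I_N * T)%type, (fun p : 'I_N * T => alpha p.1 * w p.2),
    (fun p : 'I_N * T => radjoint (q p.1) (n p.2)).
  split => //.
  - by move=> p; rewrite mulr_ge0.
  - rewrite -(pair_bigA _ (fun (i : 'I_N) t => alpha i * w t))/=.
    apply: le_trans a1'; apply: ler_sum => i _.
    by rewrite -mulr_sumr ler_piMr.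
  - move=> [i t] /=; have [rn n01] := sn t.
    have rr := radjoint_rtm X_loc_compact (qI i) rn; split; first by [].
    apply: (zero_one_open rr) => U oU; rewrite radjoint_open_or_compact; last by left.
    exact: n01.
move=> U oU; rewrite /markov_sum.
rewrite -(pair_bigA _ (fun (i : 'I_N) t => alpha i * w t * radjoint (q i) (n t) U))/=.
apply: eq_bigr => i _; rewrite radjoint_open_or_compact; last by left.
rewrite mulr_sumr; apply: eq_bigr => t _; rewrite mulrA radjoint_open_or_compact//.
by left.
Qed.

(** Each step costs one truncation. The earlier error does not grow, because [q i] maps open sets to
    open sets and the weights sum to at most 1. *)
Lemma iter_markov_hull_approx y n e : 0 < e -> exists2 m, subconvex_hull k m &
  forall U, open U -> `|iter n S (rpoint_mass y) U - m U| <= e.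
Proof.
have [qI a0 a1] := q_alpha.
elim: n e => [|n IH] e e0.
  exists (rpoint_mass y); first exact: subconvex_hull_point.
  by move=> U _; rewrite subrr normr0 ltW.
have e2 : 0 < e / 2 by lra.
have [m hm mn] := IH _ e2.
have rn : rtm k (iter n S (rpoint_mass y)).
  by apply: (iter_markov_rtm X_loc_compact q_alpha); exact: rpoint_mass_rtm.
have [N SN] := filter_ex (markov_sum_close X_loc_compact q_alpha rn e2).
have [m' hm' m'E] := subconvex_hull_markov_sum N hm.
exists m' => // U oU; rewrite m'E//=; have := SN U.
have a1' := partial_weights_le1 N a0 a1.
suff : `|markov_sum q alpha (iter n S (rpoint_mass y)) N U - markov_sum q alpha m N
  U| <= e / 2.
  by rewrite !ler_norml => /andP[? ?] /andP[? ?]; apply/andP; split; lra.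
rewrite /markov_sum -sumrB; apply: (le_trans (ler_norm_sum _ _ _)).
apply: (@le_trans _ _ (\sum_(i < N) alpha i * (e / 2))); last first.
  by rewrite -mulr_suml -[leRHS]mul1r ler_wpM2r// ltW.
apply: ler_sum => i _; rewrite -mulrBr normrM ger0_norm//; apply: ler_wpM2l => //.
rewrite !radjoint_open_or_compact; try by left.
by apply: mn; apply: image_open oU; exact: image_transformation_Deficient (qI i).
Qed.

End markov.

Lemma initial_topology_cvg (S : choiceType) (T : topologicalType) (f : S -> T)
    (F : set_system S) (s : S) : Filter F ->
  f @ F --> f s -> F --> (s : initial_topology f).
Proof.
move=> FF fs A /= [B [[C oC <-] Cs sCA]]; apply: filterS sCA _.
by apply: fs; exact: open_nbhs_nbhs.
Qed.

Lemma weak_closure_sequence (E : set (set X -> \bar R)) (ms : nat -> set X -> R) m :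
  (forall n, E (EFin \o ms n)) ->
  (forall f, C0 f -> (forall x, 0 <= f x) -> forall e, 0 < e ->
    \forall n \near \oo, `|qint (EFin \o ms n) f - qint (EFin \o m) f| <= e) ->
  closure (E : set weak_space) (EFin \o m).
Proof.
move=> Ems mm; pose F := (fun n => EFin \o ms n) @ \oo.
have FF : ProperFilter F by exact: fmap_proper_filter.
have cvgF : F --> (EFin \o m : weak_space).
  (* The product topology is the supremum of the topologies induced by its coordinates, so one
     function [f] is treated at a time. *)
  apply: initial_topology_cvg; apply/cvg_sup => -[f [C0f f0]].
  apply: initial_topology_cvg => /=; apply/cvgrPdist_le => e e0.
  by apply: filterS (mm f C0f f0 e e0) => n; rewrite distrC.
move=> A /cvgF FA; have FE : F E by exists 0%N => // n _; exact: Ems.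
exact: filter_ex (filterI FE FA).
Qed.

(** Total mass 1 ties the integral to the values of [f], even when constants are test functions. The
    extra 1 keeps the ends of the middle interval off the range of [f]. *)
Lemma qint_mass1 k m f y D : rtm k m -> m setT = 1 -> continuous f ->
  (forall x, `|f x - f y| <= D) -> `|qint (EFin \o m) f - f y| <= D + 1.
Proof.
move=> rm m1 cf fD; have D0 : 0 <= D by apply: le_trans (fD y).
pose C := `|f y| + D + 1.
have C0 : 0 <= C by rewrite !addr_ge0.
have := ler_norm (f y); have := ler_norm (- f y); rewrite normrN => n1 n2.
have fC x : `|f x| <= C.
  by have := fD x; rewrite !ler_norml => /andP[? ?]; rewrite /C; apply/andP; split; lra.
rewrite (qint_level rm cf C0 fC) m1 mulr1.
have li a b := nonincreasing_integrable a b (level_nonincreasing rm cf).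
have l01 t : 0 <= level m f t <= 1 by have := level_bounds f t rm; rewrite m1.
pose a := f y - (D + 1); pose b := f y + (D + 1).
have Ca : - C <= a by rewrite /C /a; lra.
have bC : b <= C by rewrite /C /b; lra.
have ab : a <= b by rewrite /a /b; lra.
rewrite (@integral_itv_split _ _ (- C) a C) ?(@integral_itv_split _ _ a b C)//;
  last by exact: le_trans bC.
have la t : - C <= t <= a -> 1 <= level m f t <= 1.
  move=> /andP[_ ta]; rewrite /level (_ : [set x | _] = setT) ?m1 ?lexx//.
  apply/seteqP; split => // x _ /=; have := fD x; rewrite ler_norml => /andP[? _].
  by rewrite /a in ta; lra.
have lb t : b <= t <= C -> 0 <= level m f t <= 0.
  move=> /andP[bt _]; rewrite /level (_ : [set x | _] = set0) ?(rtm_set0 rm) ?lexx//.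
  apply/seteqP; split => // x /=; have := fD x; rewrite ler_norml => /andP[_ ?] tx.
  by rewrite /b in bt; lra.
have /andP[a1 a2] := integral_itv_bounds Ca (li _ _) la.
have /andP[b1 b2] := integral_itv_bounds bC (li _ _) lb.
have /andP[c1 c2] := integral_itv_bounds ab (li _ _) (fun t _ => l01 t).
rewrite ler_norml; apply/andP; rewrite /a /b in a1 a2 b1 b2 c1 c2 *; split; lra.
Qed.

(** Boundedness of [X] and total mass 1 put a point mass at finite distance from [m], so its
    iterates approach [m] in [dKR]. Lipschitz functions need not exhaust [C0plus]; vague convergence
    carries the limit over to the weak topology. *)
Lemma markov_fixed_point_representable k q alpha (s D : R) m :
  transformation_system k q alpha -> system_contractivity_factor k q s -> s < 1 ->
  (forall x y : X, mdist x y <= D) -> rtm k m -> m setT = 1 ->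
  rmarkov q alpha m = m -> representable k (EFin \o m).
Proof.
move=> qa qs s1 XD rm m1 Sm; split; first by apply/finite_tmP; exists m.
have /set0P[y _] : [set: X] != set0.
  by apply/eqP => XE; move: m1; rewrite XE (rtm_set0 rm) => /eqP;
    rewrite eq_sym oner_eq0.
have ry := rpoint_mass_rtm k y.
have D0 : 0 <= D by apply: le_trans (XD y y); exact: mdist_ge0.
(* Both integrals are within [D + 1] of [f y]. *)
have close : Lip_close k (2 * (D + 1)) (rpoint_mass y) m.
  move=> f [[cf fL] _ _].
  have fD x : `|f x - f y| <= D by apply: le_trans (fL x y) _; rewrite mul1r.
  have y1 : rpoint_mass y setT = 1 :> R by apply: rpoint_mass1 => //; left;
    exact: openT.
  have := qint_mass1 ry y1 cf fD; have := qint_mass1 rm m1 cf fD.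
  by rewrite !ler_norml => /andP[? ?] /andP[? ?]; apply/andP; split; lra.
have D2 : 0 <= 2 * (D + 1) by lra.
pose ms n := iter n (rmarkov q alpha) (rpoint_mass y).
have rms n : rtm k (ms n) by exact: (iter_markov_rtm X_loc_compact qa).
have Sn n : iter n (rmarkov q alpha) m = m by elim: n => //= n ->.
have msc n : Lip_close k (s ^+ n * (2 * (D + 1))) (ms n) m.
  by rewrite -(Sn n); exact: (iter_markov_close X_loc_compact qa qs).
have vc : vague_cvg ms m.
  apply: (Lip_cvg_vague X_loc_compact rms rm) => f Lf e e0.
  apply: filterS (exprn_small qs s1 D2 e0) => n; apply: le_trans; exact: msc.
have msB n : ms n setT <= 1.
  apply: (le_trans (iter_markov_setT X_loc_compact qa n ry)).
  by rewrite rpoint_mass1//; left; exact: openT.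
have approx n : exists m', subconvex_hull k m' /\
    forall U, open U -> `|ms n U - m' U| <= n.+1%:R^-1.
  by have [m' ? ?] := iter_markov_hull_approx qa y n (e :=
    n.+1%:R^-1) ltac:(by rewrite invr_gt0); exists m'.
have [ns nsP] := choice approx.
apply: (@weak_closure_sequence _ ns).
  by move=> n; apply: subconvex_hull_convex; case: (nsP n).
move=> f C0f f0 e e0; have e2 : 0 < e / 2 by lra.
have h1 := vague_cvg_qint rms rm msB vc C0f (fun _ => f0) e2.
have [C C_gt0 fC] := C0_bounded C0f; have [cf _] := C0f.
have : \forall n \near \oo, 4 * C * n.+1%:R^-1 <= e / 2.
  have d0 : 0 < e / 2 / (4 * C) by rewrite divr_gt0// mulr_gt0.
  apply: filterS (near_infty_natSinv_lt (PosNum d0)) => n /= /ltW.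
  by rewrite ler_pdivlMr ?mulr_gt0// mulrC.
move=> h2; apply: filterS (filterI h1 h2) => n [{}h1 {}h2].
have [hn nU] := nsP n.
have h3 := le_trans (qint_close (rms n) (subconvex_hull_rtm hn) cf (ltW C_gt0) fC nU)
  h2.
by move: h1 h3; rewrite !ler_norml => /andP[? ?] /andP[? ?]; apply/andP; split; lra.
Qed.

End representability.

(** An arbitrary bounded family need be neither invariant under the operator nor closed, and on a
    compact space measures of different mass are at infinite distance, since all nonnegative
    constants are test functions. The conditions in the uniqueness and existence clauses account for
    this. *)
Theorem theorem55 (R : realType) (X : metricType R)
    (X_loc_compact : locally_compact [set: X])
    (X_bounded : exists D : R, forall x y : X, mdist x y <= D)
    (k : kind) (M : set (set X -> \bar R))
    (M_tm : forall mu, M mu -> finite_tm k mu)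
    (M_bounded : bounded_in_variation M)
    (q : nat -> set X -> set X) (alpha : nat -> R) (s : R)
    (q_alpha : transformation_system k q alpha)
    (q_s : system_contractivity_factor k q s) (s_lt1 : s < 1) :
  [/\ (forall mu, M mu -> finite_tm k (markov_operator q alpha mu)),
      dKR_contracting k M (markov_operator q alpha),
      dKR_finite k M -> is_subset1 (fixed_in M (markov_operator q alpha)),
      dKR_finite k M -> M !=set0 -> markov_operator q alpha @` M `<=` M ->
        dKR_closed k M -> fixed_in M (markov_operator q alpha) !=set0
    & M = DTM1 \/ M = TM1 ->
        fixed_in M (markov_operator q alpha) `<=` [set mu0 | representable k mu0]].
Proof.
have M_rtm mu : M mu -> exists2 m, rtm k m & mu = EFin \o m.
  by move=> /M_tm/finite_tmP.
have s0 := contractivity_factor_gt0 q_s.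
have SE := markov_operator_EFin X_loc_compact q_alpha.
have fixE m : rtm k m -> markov_operator q alpha (EFin \o m) = EFin \o m ->
    rmarkov q alpha m = m.
  by move=> rm; rewrite (SE m rm) => Sm; apply/funext => A;
    have [] := congr1 (@^~ A) Sm.
split.
- move=> _ /M_rtm[m rm ->]; apply/finite_tmP; exists (rmarkov q alpha m);
    last exact: SE.
  exact: rmarkov_rtm rm.
- exists s; first by rewrite ltW.
  move=> _ _ /M_rtm[m rm ->] /M_rtm[m' rm' ->]; rewrite (SE m rm) (SE m' rm').
  (* At infinite distance the bound is trivial because [0 < s]; in the extended reals [0 * +oo] is
     0. *)
  have [fin|] := ltP (dKR k (EFin \o m) (EFin \o m')) +oo%E; last first.
    by rewrite leye_eq => /eqP ->; rewrite gt0_muley ?lte_fin// leey.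
  have [D0 mm] := dKR_fine fin.
  rewrite -(@fineK _ (dKR k (EFin \o m) (EFin \o m'))) ?ge0_fin_numE ?dKR_ge0//.
  by rewrite -EFinM; apply/Lip_close_dKR; exact: Lip_close_markov.
- move=> fin mu mu' [Mmu Smu] [Mmu' Smu'].
  have mm := fin _ _ Mmu Mmu'.
  have [m rm muE] := M_rtm _ Mmu; have [m' rm' mu'E] := M_rtm _ Mmu'.
  rewrite muE mu'E in Smu Smu' mm *; have [D0 mm'] := dKR_fine mm.
  congr (_ \o _); apply: (markov_fixed_point_unique X_loc_compact q_alpha q_s s_lt1
    rm rm' D0 mm').
    exact: fixE.
  exact: fixE.
- move=> fin [mu Mmu] SM Mcl; have [m rm muE] := M_rtm _ Mmu.
  have MS n : M (EFin \o iter n (rmarkov q alpha) m).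
    elim: n => [|n IH]; first by rewrite /= -muE.
    rewrite iterS -SE; last exact: (iter_markov_rtm X_loc_compact q_alpha).
    by apply: SM; exists (EFin \o iter n (rmarkov q alpha) m).
  have [D0 mm] := dKR_fine (fin _ _ (MS 0%N) (MS 1%N)).
  have [m0 [rm0 Sm0 lim]] := markov_fixed_point_exists X_loc_compact q_alpha q_s
    s_lt1 rm D0 mm.
  exists (EFin \o m0); split; last by rewrite (SE _ rm0) Sm0.
  apply: Mcl; first by apply/finite_tmP; exists m0.
  move=> e e0; have e2 : 0 < e / 2 by lra.
  have [n cl] := lim _ e2; exists (EFin \o iter n (rmarkov q alpha) m) => //.
  by apply: (@le_lt_trans _ _ (e / 2)%:E); [apply/Lip_close_dKR|rewrite lte_fin; lra].
- move=> ME mu [Mmu Smu]; have [m rm muE] := M_rtm _ Mmu; have [D XD] := X_bounded.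
  have mu1 : mu setT = 1%E by case: ME Mmu => -> [].
  rewrite /= muE in mu1 Smu *.
  apply: (markov_fixed_point_representable X_loc_compact q_alpha q_s s_lt1 XD rm).
    by case: mu1.
  exact: fixE.
Qed.
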